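(* There exist universal constants $c_1,c_2>0$ such that the following holds. Let $n\ge2$ and $p\ge1$ be integers with $c_1p\ge\sqrt n$, let $\Theta^*$ be a $p\times p$ diagonal matrix with positive diagonal entries, $\Sigma^*=(\Theta^* )^{-1}$, let $X\in\mathbb{R}^{n\times p}$ have i.i.d. $\mathcal{N}(0,\Sigma^* )$ rows, let $S=n^{-1}X^{\mathsf T}X$, and let $$\widehat\Theta=\operatorname{argmin}_{\Theta\in\mathcal{M}^{p\times p}}\{\langle\Theta,S\rangle-\log\det\Theta\}.$$ Then $$L^{\mathrm{ssym}}(\widehat\Theta,\Theta^* )\ge\frac{c_1}{2\sqrt n}$$ with probability at least $1-3p\exp(-c_2\min\{n,p\})$.
   Context: $\mathcal{M}^{p\times p}$ is the set of $p\times p$ symmetric positive semidefinite matrices $\Theta$ with $\Theta_{jk}\le 0$ for all $j\neq k$. $\langle A,B\rangle=\mathrm{tr}(A^{\mathsf T}B)$, and $-\log\det\Theta=+\infty$ for singular $\Theta$. For $n\ge 2$ the minimizer $\widehat\Theta$ exists, is unique and is nonsingular with probability one (a known fact). The symmetrized Stein loss between symmetric positive definite $p\times p$ matrices $\Theta,\Theta^*$ with inverses $\Sigma=\Theta^{-1}$, $\Sigma^*=(\Theta^* )^{-1}$ is $$L^{\mathrm{ssym}}(\Theta,\Theta^* )=\frac{1}{2p}\langle\Theta-\Theta^*,\Sigma^*-\Sigma\rangle .$$ ''Universal'' means not depending on $n,p,\Theta^*$. *)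

(* Defs.v *)
From HB Require Import structures.
From mathcomp Require Import all_boot all_order all_algebra.
From mathcomp Require Import all_classical all_reals all_analysis.

Set Implicit Arguments.
Unset Strict Implicit.
Unset Printing Implicit Defensive.

Import Order.TTheory GRing.Theory Num.Theory.
Import numFieldNormedType.Exports.

Local Open Scope classical_set_scope.
Local Open Scope ring_scope.

(* The integral of f over R^p with respect to Lebesgue measure, written as an
   iterated one-dimensional integral (Tonelli); meant for nonnegative f.       *)
Fixpoint lebesgue_tuple_integral (R : realType) (p : nat) :
    (p.-tuple R -> \bar R) -> \bar R :=
  match p return (p.-tuple R -> \bar R) -> \bar R with
  | 0%N => fun f => f [tuple]
  | q.+1 => fun f =>
      (\int[@lebesgue_measure R]_x
         lebesgue_tuple_integral (fun t : q.-tuple R => f [tuple of x :: t]))%E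
  end.

Definition row_of_tuple (R : realType) (p : nat) (x : p.-tuple R) : 'rV[R]_p :=
  \row_j tnth x j.

Section multivariate_normal.
Context {R : realType} {p : nat}.
Implicit Types (m : 'rV[R]_p) (Sigma : 'M[R]_p).

(* Only meaningful when Sigma is positive definite. *)
Definition mvnormal_pdf m Sigma (x : p.-tuple R) : R :=
  let y := row_of_tuple x - m in
  (Num.sqrt ((2 * pi) ^+ p * \det Sigma))^-1 *
  expR (- (y *m invmx Sigma *m y^T) 0 0 / 2).

Definition mvnormal_prob m Sigma (A : set (p.-tuple R)) : \bar R :=
  lebesgue_tuple_integral (fun x => (mvnormal_pdf m Sigma x * \1_A x)%:E).

End multivariate_normal.

Definition mutually_independent (R : realType) (d d' : measure_display)
    (T : measurableType d) (U : measurableType d') (P : probability T R)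
    (n : nat) (X : 'I_n -> {RV P >-> U}) : Prop :=
  forall (J : {set 'I_n}) (A : 'I_n -> set U),
    (forall i, i \in J -> measurable (A i)) ->
    P (\bigcap_(i in [set` J]) (X i @^-1` A i)) =
    (\prod_(i in J) P (X i @^-1` A i))%E.

Definition has_mvnormal_law (R : realType) (p : nat) (d : measure_display)
    (T : measurableType d) (P : probability T R) (Y : {RV P >-> p.-tuple R})
    (m : 'rV[R]_p) (Sigma : 'M[R]_p) : Prop :=
  forall A : set (p.-tuple R), measurable A ->
    distribution P Y A = mvnormal_prob m Sigma A.

Definition data_matrix (R : realType) (n p : nat) (T : Type)
    (X : 'I_n -> T -> p.-tuple R) (w : T) : 'M[R]_(n, p) :=
  \matrix_(i, j) tnth (X i w) j.

Section stein.
Context {R : realType}.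

Definition sample_covariance (n p : nat) (X : 'M[R]_(n, p)) : 'M[R]_p :=
  n%:R^-1 *: (X^T *m X).

Context {p : nat}.
Implicit Types (A B S Theta : 'M[R]_p).

Definition inner_mx A B : R := \tr (A^T *m B).

(* Positive semidefinite with nonpositive off-diagonal entries. *)
Definition M_matrices : set 'M[R]_p :=
  [set Theta | [/\ Theta^T = Theta,
                   forall x : 'cV[R]_p, 0 <= (x^T *m Theta *m x) 0 0 &
                   forall j k : 'I_p, j != k -> Theta j k <= 0]].

Definition neg_log_det Theta : \bar R :=
  (if Theta \in unitmx then (- ln (\det Theta))%:E else +oo)%E.

Definition stein_objective S Theta : \bar R :=
  ((inner_mx Theta S)%:E + neg_log_det Theta)%E.

Definition L_ssym Theta Theta_star : R :=
  (2 * p%:R)^-1 *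
  inner_mx (Theta - Theta_star) (invmx Theta_star - invmx Theta).

End stein.

Definition is_argmin (R : realType) (U : Type) (A : set U) (f : U -> \bar R)
    (x : U) : Prop :=
  A x /\ forall y, A y -> (f x <= f y)%E.

(* Main.v *)
Require Import Defs.
From HB Require Import structures.
From mathcomp Require Import all_boot all_order all_algebra.
From mathcomp Require Import all_classical all_reals all_analysis.
From mathcomp Require Import measurable_realfun ring lra.

Set Implicit Arguments.
Unset Strict Implicit.
Unset Printing Implicit Defensive.

Import Order.TTheory GRing.Theory Num.Theory.
Import numFieldNormedType.Exports.

Local Open Scope classical_set_scope.
Local Open Scope ring_scope.

(** Proof.  The first-order conditions for the minimizer, taken along the
    rank-one directions [- e_j e_j^T] and [(e_j - e_k) (e_j - e_k)^T], show that
    its inverse [Sigma] dominates [S] entrywise; being the inverse of an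
    M-matrix, [Sigma] is also entrywise nonnegative.  Rescale so that [Theta*] is
    the identity.  Since [Theta + Sigma - 2 I] is positive semidefinite, its
    trace, which is [2 p L], is at least its quadratic form at the unit vector
    [p^(-1/2) 1], hence at least [p^-1 sum_jk Sigma_jk - 2].  Here
    [sum_jk Sigma_jk >= sum_jk max (S_jk, 0) >= 1/2 sum_jk |S_jk|] because
    [sum_jk S_jk >= 0].  It remains to see that every column of [S] has
    [l^1]-norm at least [c p / sqrt n]: conditionally on column [k] of [X], the
    inner products with the other columns are independent centered Gaussians
    of variance the squared length of that column, and both this length and
    the sum of their absolute values are bounded below by Chernoff's method. *)

(** * Independent families and partial resampling *)

Section boxes.
Context {R : realType} {I : finType}.

Definition box (A : I -> set R) : set (I -> R) := [set z | forall i, A i (z i)].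

Definition boxes : set (set (I -> R)) :=
  [set B | exists2 A : I -> set R, (forall i, measurable (A i)) & B = box A].

(** The product sigma-algebra, generated by a pi-system containing the whole space, so that a finite
    family of variables becomes one measurable map whose law is determined on boxes. *)
Definition cylinder_space := g_sigma_algebraType boxes.

Lemma boxes_setI : setI_closed boxes.
Proof.
move=> _ _ [A mA ->] [B mB ->]; exists (fun i => A i `&` B i).
  by move=> i; exact: measurableI.
by apply/seteqP; split=> [z [zA zB] i|z zAB]; [split | split=> i; case: (zAB i)].
Qed.

Lemma boxes_setT : boxes setT.
Proof. by exists (fun=> setT) => //; apply/seteqP; split. Qed.

Lemma measurable_coord (i : I) :
  measurable_fun setT (fun z : cylinder_space => z i : R).
Proof.
move=> _ B mB; rewrite setTI; apply: sub_sigma_algebra.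
exists (fun j => if j == i then B else setT).
  by move=> j; case: ifP.
apply/seteqP; split=> [z /= zB j|z /(_ i)]; last by rewrite eqxx.
by case: eqP => [->|].
Qed.

Lemma measurable_to_cylinder_space d (T : measurableType d)
    (f : T -> cylinder_space) :
  (forall i, measurable_fun setT (fun w => f w i)) -> measurable_fun setT f.
Proof.
move=> mf; apply: (@measurability _ _ T cylinder_space setT f boxes) => //
  _ [_ [A mA ->] <-].
rewrite setTI.
have -> : f @^-1` box A = \bigcap_(i in [set: I]) ((fun w => f w i) @^-1` A i).
  by apply/seteqP; split=> [w H i _|w H i]; apply: H.
apply: fin_bigcap_measurable; first exact: finite_finset.
by move=> i _; rewrite -[X in measurable X]setTI; exact: mf.
Qed.

End boxes.
Arguments cylinder_space : clear implicits.

Section independence.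
Context {R : realType} {I : finType} {d} {T : measurableType d}.
Variables (P : probability T R) (Z : I -> T -> R).

(** Taking [A i] to be [setT] outside a subset of indices recovers the product rule for every
    subfamily. *)
Definition box_independent := forall A : I -> set R,
  (forall i, measurable (A i)) ->
  P [set w | forall i, A i (Z i w)] = (\prod_i P (Z i @^-1` A i))%E.

Hypothesis mZ : forall i, measurable_fun setT (Z i).
Hypothesis indepZ : box_independent.

Let sample (w : T) : cylinder_space R I := fun i => Z i w.

Lemma measurable_sample : measurable_fun setT sample.
Proof. exact: measurable_to_cylinder_space. Qed.

Definition splice (K : pred I) (ww : T * T) : cylinder_space R I :=
  fun i => if K i then Z i ww.1 else Z i ww.2.

Lemma measurable_splice (K : pred I) : measurable_fun setT (splice K).
Proof.
apply: measurable_to_cylinder_space => i; rewrite /splice; case: (K i).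
- exact: (measurableT_comp (mZ i) measurable_fst).
- exact: (measurableT_comp (mZ i) measurable_snd).
Qed.


(** The event is a rectangle: the constraints in [K] bear on the first copy, the others on the
    second. Padding each side with [setT] makes both full boxes, to which independence applies. *)
Lemma splice_box (K : pred I) (A : I -> set R) :
  (forall i, measurable (A i)) ->
  (P \x P)%E (splice K @^-1` box A) = P [set w | forall i, A i (Z i w)].
Proof.
move=> mA; pose A1 i := if K i then A i else setT.
pose A2 i := if K i then setT else A i.
have mA1 i : measurable (A1 i) by rewrite /A1; case: ifP.
have mA2 i : measurable (A2 i) by rewrite /A2; case: ifP.
have mbox B : (forall i, measurable (B i)) ->
    measurable [set w | forall i, B i (Z i w)].
  move=> mB; have := measurable_sample measurableT
    (_ : measurable (box B : set (cylinder_space R I))).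
  by rewrite setTI; apply; apply: sub_sigma_algebra; exists B.
have -> : splice K @^-1` box A =
    [set w | forall i, A1 i (Z i w)] `*` [set w | forall i, A2 i (Z i w)].
  apply/seteqP; split=> [[w1 w2] /= H|[w1 w2] /= [H1 H2] i].
    by split=> i; have := H i; rewrite /splice /A1 /A2 /=; case: ifP.
  by have := H1 i; have := H2 i; rewrite /splice /A1 /A2 /=; case: ifP.
rewrite product_measure1E; [|exact: mbox|exact: mbox].
transitivity (\prod_i P (Z i @^-1` A1 i) * \prod_i P (Z i @^-1` A2 i))%E.
  by congr (_ * _)%E; exact: indepZ.
rewrite indepZ// -big_split/=; apply: eq_bigr => i _.
rewrite /A1 /A2; case: ifP => _;
  by rewrite preimage_setT probability_setT ?mule1 ?mul1e.
Qed.

(* A family spliced from two independent copies has the law of the original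
   one.  Fixing the first copy plays the role of conditioning on the coordinates
   in [K]. *)
Lemma integral_splice (K : pred I) (F : cylinder_space R I -> \bar R) :
  measurable_fun setT F -> (forall z, 0 <= F z)%E ->
  (\int[P]_w F (sample w) =
   \int[P]_w1 \int[P]_w2 F (splice K (w1, w2)))%E.
Proof.
move=> mF F0.
pose mu1 : {measure set (cylinder_space R I) -> \bar R} := pushforward P sample.
pose mu2 : {measure set (cylinder_space R I) -> \bar R} :=
  pushforward (P \x P)%E (splice K).
pose nu1 := mu1 measurable_sample; pose nu2 := mu2 (measurable_splice K).
(* Uniqueness of measures from a generating pi-system: agreement on boxes is enough. *)
have laws (B : set (cylinder_space R I)) : measurable B -> nu1 B = nu2 B.
  refine (@measure_unique _ R (cylinder_space R I) boxes (fun=> setT) erefl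
    boxes_setI _ _ nu1 nu2 _ _ B).
  - by move=> _; exact: boxes_setT.
  - by rewrite bigcup_const.
  - by move=> _ [A mA ->]; rewrite /nu2 /= /pushforward splice_box.
  - move=> _; rewrite /nu1 /= /pushforward.
    by rewrite preimage_setT probability_setT ltry.
have E1 : (\int[nu1]_z F z = \int[P]_w F (sample w))%E.
  exact: (ge0_integral_pushforward measurable_sample P measurableT mF
    (fun y _ => F0 y)).
have E2 : (\int[nu2]_z F z = \int[P \x P]_ww F (splice K ww))%E.
  exact: (ge0_integral_pushforward (measurable_splice K) (P \x P)%E measurableT
    mF (fun y _ => F0 y)).
have E12 : (\int[nu1]_z F z = \int[nu2]_z F z)%E.
  by apply: eq_measure_integral => B mB _; exact: laws.
rewrite -E1 E12 E2 fubini_tonelli1//.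
exact: (measurableT_comp mF (measurable_splice K)).
Qed.

(** Each [phi j] sees only the coordinates of the block [b = j]. Resampling everything outside one
    block makes its factor a function of the first copy and the remaining product a function of the
    second, so the factors peel off one at a time. *)
Lemma integral_prod_blocks (J : eqType) (b : I -> J)
    (phi : J -> cylinder_space R I -> R) (s : seq J) :
  uniq s -> (forall j, measurable_fun setT (phi j)) ->
  (forall j z, 0 <= phi j z) ->
  (forall j z z', (forall i, b i = j -> z i = z' i) -> phi j z = phi j z') ->
  (\int[P]_w (\prod_(j <- s) phi j (sample w))%:E =
   \prod_(j <- s) \int[P]_w (phi j (sample w))%:E)%E.
Proof.
move=> us mphi phi0 locphi.
have mprod t : measurable_fun setT (fun z => \prod_(j <- t) phi j z).
  by apply: measurable_prod.
have prod0 t z : 0 <= \prod_(j <- t) phi j z by apply: prodr_ge0.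
have msample f : measurable_fun setT f ->
    measurable_fun setT (fun w => (f (sample w))%:E : \bar R).
  move=> mf; apply/measurable_EFinP.
  exact: (measurableT_comp mf measurable_sample).
elim: s us => [_|j s IH /= /andP[js us]].
  under eq_integral do rewrite big_nil.
  by rewrite big_nil integral_cst// mul1e; exact: probability_setT.
pose K := [pred i | b i == j].
rewrite (integral_splice K (F := fun z => (\prod_(j <- j :: s) phi j z)%:E)).
- have E w1 w2 : \prod_(j <- j :: s) phi j (splice K (w1, w2)) =
      phi j (sample w1) * \prod_(j <- s) phi j (sample w2).
    rewrite big_cons; congr (_ * _).
      by apply: locphi => i bij; rewrite /splice /= bij eqxx.
    rewrite big_seq [RHS]big_seq; apply: eq_bigr => j' j's.
    apply: locphi => i bij; rewrite /splice /= bij; case: eqP => // jj.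
    by rewrite -jj j's in js.
  have inner w1 :
      (\int[P]_w2 (\prod_(j <- j :: s) phi j (splice K (w1, w2)))%:E =
       (phi j (sample w1))%:E *
       \prod_(j <- s) \int[P]_w (phi j (sample w))%:E)%E.
    under eq_integral do rewrite E EFinM.
    rewrite ge0_integralZl_EFin ?IH//; first by move=> w2 _; rewrite lee_fin.
    exact: (msample _ (mprod s)).
  under eq_integral do rewrite inner.
  rewrite /= ge0_integralZr//.
  + by rewrite big_cons.
  + exact: (msample _ (mphi j)).
  + by move=> w _; rewrite lee_fin.
  + by apply: prode_ge0 => j' _; apply: integral_ge0 => w _; rewrite lee_fin.
- by apply/measurable_EFinP; exact: mprod.
- by move=> z; rewrite lee_fin.
Qed.

Lemma integral_expR_linear :
  (forall i t, \int[P]_w (expR (t * Z i w))%:E = (expR (t ^+ 2 / 2))%:E)%E ->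
  forall t : I -> R, (\int[P]_w (expR (\sum_i t i * Z i w))%:E =
    (expR ((\sum_i t i ^+ 2) / 2))%:E)%E.
Proof.
move=> mgfZ t.
under eq_integral do rewrite expR_sum.
rewrite (integral_prod_blocks (b := id)
  (phi := fun i z => expR (t i * z i)) (index_enum_uniq I)).
- under eq_bigr do rewrite mgfZ.
  by rewrite prodEFin -expR_sum mulr_suml.
- move=> i; apply: measurableT_comp => //.
  by apply: measurable_funM => //; exact: measurable_coord.
- by move=> i z; exact: expR_ge0.
- by move=> i z z' zz'; rewrite zz'.
Qed.

End independence.

(** * A Laplace transform bound from the moment generating function *)


Section laplace.
Context {R : realType}.

(* [y = cosh x - 1] satisfies [y (20 - y) <= 500 (1 - e^-|x|)]; the left-hand
   side is a combination of the exponentials [e^(+-x)] and [e^(+-2x)]. *)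
Lemma expRN_norm_le (x : R) :
  expR (- `|x|) + 11 / 500 * (expR x + expR (- x)) <=
  1 + 43 / 1000 + 2000^-1 * (expR (2 * x) + expR (- (2 * x))).
Proof.
set a := expR `|x|; set b := expR (- `|x|).
have ab : a * b = 1 by rewrite /a /b expRxMexpNx_1.
have a1 : 1 <= a by rewrite /a -expR0 ler_expR.
have b0 : 0 < b by exact: expR_gt0.
have -> : expR x + expR (- x) = a + b.
  by rewrite /a /b; case: (ger0P x) => // _; rewrite opprK addrC.
have -> : expR (2 * x) + expR (- (2 * x)) = a ^+ 2 + b ^+ 2.
  rewrite /a /b -!expRM_natl -mulrN; case: (ger0P x) => // _.
  by rewrite opprK addrC.
have b1 : b <= 1 by nra.
(* With [y = (a + b) / 2 - 1], the threshold 42 is [y = 20], beyond which [y (20 - y)] is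
   nonpositive. Below it, [(a - 1) (1 - b) = 2 y] and [a - 1 <= 2 y + 1] bound [1 - b] from
   below. *)
have [y20|y20] := leP 42 (a + b).
  nra.
have : (a - 1) * (1 - b) = a + b - 2 by nra.
nra.
Qed.

(* Upper bound on [E e^-|W|] for [W] standard normal: integrate [expRN_norm_le]
   using [E e^(tW) = e^(t^2/2)]. *)
Definition laplace_bound : R :=
  1 + 43 / 1000 + 1000^-1 * expR 2 - 11 / 250 * expR (2^-1).

Lemma expR_half_le2 : expR (2^-1) <= 2 :> R.
Proof.
have : 1 - 2^-1 <= expR (- 2^-1) :> R := expR_ge1Dx _.
have := expRxMexpNx_1 (2^-1 : R); have := expR_gt0 (2^-1 : R).
set u := expR _; set u' := expR _ => u0 uu' u'1.
have : 0 <= u * (u' - 2^-1) by apply: mulr_ge0; lra.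
lra.
Qed.

(** With [u = e^(1/2)] between 3/2 and 2, the bound is [1.043 + u^4 / 1000 - 0.044 u], at most
    [1.043 + 0.016 - 0.066 = 0.993]. *)
Lemma laplace_bound_lt1 : laplace_bound < 1.
Proof.
rewrite /laplace_bound.
have e1 : 1 + 2^-1 <= expR (2^-1) :> R := expR_ge1Dx _.
have e2 := expR_half_le2.
have -> : expR 2 = expR (2^-1) ^+ 4 :> R.
  by rewrite -expRM_natl; congr expR; field.
have : expR 2^-1 ^+ 4 <= 2 ^+ 4 :> R by rewrite lerXn2r ?nnegrE ?expR_ge0.
lra.
Qed.

(** This gives [e^L <= 2] for [L = - ln laplace_bound], the price of having [p - 1] rather than [p]
    columns in the tail bound. *)
Lemma laplace_bound_ge : 2^-1 <= laplace_bound :> R.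
Proof.
by rewrite /laplace_bound; have := expR_ge0 (2 : R); have := expR_half_le2; lra.
Qed.

(** The pointwise inequality is integrated with nonnegative terms on both sides; the subtraction
    happens only afterwards, between finite numbers. *)
Lemma integral_expRN_norm_std d (T : measurableType d) (P : probability T R)
    (U : T -> R) (a b c : R) :
  0 <= a -> 0 <= b -> 0 <= c ->
  (forall x : R, expR (- `|x|) + a * (expR x + expR (- x)) <=
     b + c * (expR (2 * x) + expR (- (2 * x)))) ->
  measurable_fun setT U ->
  (forall s, \int[P]_w (expR (s * U w))%:E = (expR (s ^+ 2 / 2))%:E)%E ->
  (\int[P]_w (expR (- `|U w|))%:E <=
   (b + 2 * c * expR 2 - 2 * a * expR (2^-1))%:E)%E.
Proof.
move=> a0 b0 c0 abc mU mgfU.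
have mexp (s : R) : measurable_fun setT (fun w => (expR (s * U w))%:E : \bar R).
  apply/measurable_EFinP; apply: measurableT_comp => //.
  exact: measurable_funM.
have mabs : measurable_fun setT (fun w => (expR (- `|U w|))%:E : \bar R).
  apply/measurable_EFinP; apply: measurableT_comp => //.
  apply: measurableT_comp => //; exact: measurableT_comp.
pose S s w : \bar R := ((expR (s * U w))%:E + (expR (- s * U w))%:E)%E.
have mS s : measurable_fun setT (S s) by apply: emeasurable_funD.
have S0 s w : (0 <= S s w)%E.
  by rewrite /S -EFinD lee_fin addr_ge0 ?expR_ge0.
have intS (k s : R) : 0 <= k -> (\int[P]_w (k%:E * S s w) =
    (2 * k * expR (s ^+ 2 / 2))%:E)%E.
  move=> k0.
  rewrite (ge0_integralZl_EFin P measurableT (fun w _ => S0 s w) (mS s) k0).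
  rewrite /S ge0_integralD//; try by move=> w _; rewrite lee_fin expR_ge0.
  by rewrite !mgfU sqrrN -EFinD -EFinM; congr _%:E; ring.
have mkS (k s : R) : measurable_fun setT (fun w => (k%:E * S s w)%E).
  exact: measurable_funeM.
have kS0 (k s : R) w : 0 <= k -> (0 <= k%:E * S s w)%E.
  by move=> k0; rewrite mule_ge0.
have e0 w : (0 <= (expR (- `|U w|))%:E)%E by rewrite lee_fin expR_ge0.
have lhs : (\int[P]_w ((expR (- `|U w|))%:E + a%:E * S 1%R w) =
    \int[P]_w (expR (- `|U w|))%:E + (2 * a * expR (2^-1))%:E)%E.
  rewrite (ge0_integralD P measurableT (fun w _ => e0 w) mabs
    (fun w _ => kS0 a (1 : R) w a0) (mkS a (1 : R))).
  by rewrite intS// expr1n mul1r.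
have rhs : (\int[P]_w (b%:E + c%:E * S 2%R w) = (b + 2 * c * expR 2)%:E)%E.
  have b0' (w : T) : [set: T] w -> (0 <= b%:E)%E by rewrite lee_fin.
  rewrite (ge0_integralD P measurableT b0' (measurable_cst _)
    (fun w _ => kS0 c (2 : R) w c0) (mkS c (2 : R))).
  rewrite intS// integral_cst// [X in (_ * X + _)%E]probability_setT mule1 -EFinD.
  by congr (_ + _ * expR _)%:E; field.
rewrite EFinB leeBrDr// -lhs -rhs.
apply: ge0_le_integral => //.
- by move=> w _; apply: adde_ge0 => //; exact: kS0.
- by apply: emeasurable_funD.
- by apply: emeasurable_funD.
- by move=> w _; have := abc (U w); rewrite -lee_fin /S mul1r mulN1r mulNr.
Qed.

(** Standardizing to [U = W / sqrt v] only shrinks the absolute value, since [v >= 1], and so only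
    increases [e^-|.|]. *)
Lemma integral_expRN_norm d (T : measurableType d) (P : probability T R)
    (W : T -> R) (v : R) :
  measurable_fun setT W -> 1 <= v ->
  (forall s, \int[P]_w (expR (s * W w))%:E = (expR (s ^+ 2 * v / 2))%:E)%E ->
  (\int[P]_w (expR (- `|W w|))%:E <= laplace_bound%:E)%E.
Proof.
move=> mW v1 mgfW.
have v0 : 0 < v by lra.
pose U w := (Num.sqrt v)^-1 * W w.
have mU : measurable_fun setT U by exact: measurable_funM.
have mgfU s : (\int[P]_w (expR (s * U w))%:E = (expR (s ^+ 2 / 2))%:E)%E.
  under eq_integral do rewrite /U mulrA.
  rewrite mgfW exprMn exprVn sqr_sqrtr ?ltW//; congr (expR _)%:E.
  by field; rewrite gt_eqF.
have mabs : measurable_fun setT (fun w => (expR (- `|U w|))%:E : \bar R).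
  apply/measurable_EFinP; apply: measurableT_comp => //.
  apply: measurableT_comp => //; exact: measurableT_comp.
apply: (@le_trans _ _ (\int[P]_w (expR (- `|U w|))%:E)%E).
  apply: ge0_le_integral => //.
  - apply/measurable_EFinP; apply: measurableT_comp => //.
    apply: measurableT_comp => //; exact: measurableT_comp.
  - move=> w _; rewrite lee_fin ler_expR lerN2 /U normrM.
    rewrite ger0_norm ?invr_ge0 ?sqrtr_ge0// ler_piMl//.
    rewrite invf_le1 ?sqrtr_gt0//.
    by rewrite -[leLHS]sqrtr1 ler_wsqrtr.
have -> : laplace_bound =
    1 + 43 / 1000 + 2 * 2000^-1 * expR 2 - 2 * (11 / 500) * expR (2^-1).
  by rewrite /laplace_bound; congr (_ + _ * _ - _ * _); field.
apply: integral_expRN_norm_std mU mgfU; try lra.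
exact: expRN_norm_le.
Qed.

End laplace.

(** * Lower tail of the columns of a Gaussian Gram matrix *)


Lemma prode_le_exprn (R : realType) (J : Type) (s : seq J) (x : J -> \bar R)
    (c : R) :
  (forall j, 0 <= x j)%E -> (forall j, x j <= c%:E)%E ->
  (\prod_(j <- s) x j <= (c ^+ size s)%:E)%E.
Proof.
move=> x0 xc; elim: s => [|j s IH]; first by rewrite big_nil expr0.
rewrite big_cons /= exprS EFinM; apply: lee_pmul => //.
by apply: prode_ge0 => i _.
Qed.

Section gram.
Context {R : realType} {n p : nat} {d} {T : measurableType d}.
Variables (P : probability T R) (Z : 'I_n * 'I_p -> T -> R).
Hypothesis mZ : forall ij, measurable_fun setT (Z ij).
Hypothesis indepZ : box_independent P Z.
Hypothesis mgfZ : forall ij t,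
  (\int[P]_w (expR (t * Z ij w))%:E = (expR (t ^+ 2 / 2))%:E)%E.

Let sample w : cylinder_space R ('I_n * 'I_p)%type := fun ij => Z ij w.

Lemma measurable_column_form (a : 'I_n -> R) (j : 'I_p) :
  measurable_fun setT
    (fun z : cylinder_space R ('I_n * 'I_p)%type => \sum_i a i * z (i, j)).
Proof.
apply: measurable_sum => i; apply: measurable_funM => //.
exact: measurable_coord.
Qed.

Lemma integral_expRN_column_form (a : 'I_n -> R) (j : 'I_p) :
  1 <= \sum_i a i ^+ 2 ->
  (\int[P]_w (expR (- `|\sum_i a i * Z (i, j) w|))%:E <=
   (laplace_bound : R)%:E)%E.
Proof.
move=> a1; apply: integral_expRN_norm a1 _.
  by apply: measurable_sum => i; apply: measurable_funM.
(* Extending [s a] by zero outside column [j] turns the form into a linear form in all entries,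
   whose moment generating function is known: it is Gaussian of variance [sum_i a_i^2]. *)
move=> s; pose t (ij : 'I_n * 'I_p) := if ij.2 == j then s * a ij.1 else 0.
have sumt (g : R -> 'I_n * 'I_p -> R) : (forall ij, g 0 ij = 0) ->
    \sum_ij g (t ij) ij = \sum_i g (s * a i) (i, j).
  move=> g0; rewrite (eq_bigr (fun ij => g (t (ij.1, ij.2)) (ij.1, ij.2)));
    last by case.
  rewrite -(pair_bigA _ (fun i l => g (t (i, l)) (i, l)))/=.
  apply: eq_bigr => i _; rewrite (bigD1 j)//= big1 ?addr0.
    by rewrite /t /= eqxx.
  by move=> l lj; rewrite /t /= (negbTE lj).
have := integral_expR_linear mZ indepZ mgfZ t.
rewrite (sumt (fun x _ => x ^+ 2)); last by move=> _; rewrite expr0n.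
under eq_integral => w _.
  rewrite (sumt (fun x ij => x * Z ij w)); last by move=> ij; rewrite mul0r.
  under eq_bigr do rewrite -mulrA.
  rewrite -mulr_sumr. over.
move=> ->; congr (expR (_ / 2))%:E.
by under eq_bigr do rewrite exprMn; rewrite mulr_sumr.
Qed.

(** The blocks are the [p - 1] columns other than [k]; for a fixed vector [a], their forms are
    independent. *)
Lemma integral_expRN_other_columns (a : 'I_n -> R) (k : 'I_p) :
  1 <= \sum_i a i ^+ 2 ->
  (\int[P]_w (expR (- \sum_(j | j != k) `|\sum_i a i * Z (i, j) w|))%:E <=
   ((laplace_bound : R) ^+ p.-1)%:E)%E.
Proof.
move=> a1.
have -> : p.-1 = size (enum (predC1 k)) by rewrite -cardE cardC1 card_ord.
under eq_integral => w _.
  rewrite -sumrN expR_sum -big_enum. over.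
rewrite /= (integral_prod_blocks mZ indepZ (b := snd)
  (phi := fun j z => expR (- `|\sum_i a i * z (i, j)|))).
- apply: prode_le_exprn => j; last exact: integral_expRN_column_form.
  by apply: integral_ge0 => w _; rewrite lee_fin expR_ge0.
- exact: enum_uniq.
- move=> j; apply: measurableT_comp => //; apply: measurableT_comp => //.
  by apply: measurableT_comp => //; exact: measurable_column_form.
- by move=> j z; exact: expR_ge0.
- move=> j z z' zz'; congr (expR (- `|_|)).
  by apply: eq_bigr => i _; rewrite zz'.
Qed.

(** The blocks are now the rows. The [l^1]-norm of the column stands in for its length, because its
    Laplace transform factors into terms already bounded. *)
Lemma integral_expRN_column (k : 'I_p) :
  (\int[P]_w (expR (- \sum_i `|Z (i, k) w|))%:E <=
   ((laplace_bound : R) ^+ n)%:E)%E.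
Proof.
under eq_integral => w _.
  rewrite -sumrN expR_sum. over.
rewrite /= (integral_prod_blocks mZ indepZ (b := fst)
  (phi := fun i z => expR (- `|z (i, k)|)) (index_enum_uniq _)).
- have sz : size (index_enum 'I_n) = n.
    by rewrite -[RHS]card_ord cardE enumT.
  rewrite -[in X in (_ <= X)%E]sz; apply: prode_le_exprn => i.
    by apply: integral_ge0 => w _; rewrite lee_fin expR_ge0.
  apply: (integral_expRN_norm (v := 1)) => // s.
  by rewrite mulr1.
- move=> i; apply: measurableT_comp => //; apply: measurableT_comp => //.
  by apply: measurableT_comp => //; exact: measurable_coord.
- by move=> i z; exact: expR_ge0.
- by move=> i z z' zz'; rewrite zz'.
Qed.


Lemma measurable_column_gram (k : 'I_p) :
  measurable_fun setT (fun z : cylinder_space R ('I_n * 'I_p)%type =>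
    \sum_(j | j != k) `|\sum_i z (i, k) * z (i, j)|).
Proof.
under [X in measurable_fun _ X]eq_fun do rewrite -big_filter.
apply: measurable_sum => j; apply: measurableT_comp => //.
apply: measurable_sum => i.
by apply: measurable_funM; exact: measurable_coord.
Qed.

(** Column [k] is fixed by splicing. If it is short, Markov's inequality on its [l^1]-norm gives the
    term in [n]; if it is long, Chernoff's bound on the other columns gives the term in [p]. *)
Lemma column_gram_lower_tail (k : 'I_p) (L : R) :
  (0 < n)%N -> 0 < L -> laplace_bound = expR (- L) -> expR L <= 2 ->
  (P [set w | (\sum_(j | j != k) `|\sum_i Z (i, k) w * Z (i, j) w| <
               L ^+ 2 / 4 * p%:R * Num.sqrt n%:R)%R] <=
   (2 * expR (- (L / 2 * p%:R)) + expR (- (L / 2 * n%:R)))%:E)%E.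
Proof.
move=> n0 L0 LE L2; set thr := L ^+ 2 / 4 * _ * _.
set sqn := Num.sqrt n%:R in thr *.
have sqn0 : 0 < sqn by rewrite sqrtr_gt0 ltr0n.
have sqnE : sqn * sqn = n%:R by rewrite -expr2 sqr_sqrtr ?ler0n.
pose G (z : cylinder_space R ('I_n * 'I_p)%type) :=
  \sum_(j | j != k) `|\sum_i z (i, k) * z (i, j)|.
pose B : set (cylinder_space R ('I_n * 'I_p)%type) := [set z | G z < thr].
have mB : measurable B.
  have := measurable_column_gram k measurableT (measurable_itv `]-oo, thr[).
  by rewrite setTI; congr measurable; apply/seteqP; split=> z;
    rewrite /B /= in_itv.
have mS := measurable_sample mZ.
have mSB : measurable (sample @^-1` B) by rewrite -[X in measurable X]setTI; exact: mS.
pose F (z : cylinder_space R ('I_n * 'I_p)%type) : \bar R := (\1_B z)%:E.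
have mF : measurable_fun setT F by apply/measurable_EFinP; exact: measurable_indic.
have F0 z : (0 <= F z)%E by rewrite lee_fin.
have -> : P [set w | (\sum_(j | j != k) `|\sum_i Z (i, k) w * Z (i, j) w| < thr)%R]
    = (\int[P]_w F (sample w))%E.
  by rewrite integral_indic// setIT.
pose K := [pred ij : 'I_n * 'I_p | ij.2 == k].
rewrite (integral_splice mZ indepZ K mF F0).
have mFs : measurable_fun setT (F \o splice Z K).
  exact: (measurableT_comp mF (measurable_splice mZ K)).
pose C := 2 * expR (- (L / 2 * p%:R)).
(* Markov weight of the event that column [k] is short: it is at least 1 there. *)
pose small w := expR (L / 2 * n%:R - \sum_i `|Z (i, k) w|).
have C0 : 0 <= C by rewrite mulr_ge0 ?expR_ge0.
have msmall : measurable_fun setT (fun w => (small w)%:E : \bar R).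
  apply/measurable_EFinP; apply: measurableT_comp => //.
  apply: measurable_funB => //; apply: measurable_sum => i.
  exact: measurableT_comp.
have inner w1 : (\int[P]_w2 F (splice Z K (w1, w2)) <= (C + small w1)%:E)%E.
  have msec : measurable_fun setT (fun w2 => F (splice Z K (w1, w2))).
    exact: (measurable_fun_pair2 w1 mFs).
  (* First case: the column is short, and the inner probability, at most 1, is at most
     [small w1]. *)
  have [big|] := ltrP (\sum_i `|Z (i, k) w1|) (L / 2 * n%:R).
    apply: (@le_trans _ _ 1%E).
      apply: (@le_trans _ _ (\int[P]_w2 1%:E)%E).
        apply: ge0_le_integral => // w2 _.
        by rewrite lee_fin indicE lern1 leq_b1.
      by rewrite integral_cst// mul1e; exact: probability_le1.
    rewrite lee_fin -[leLHS]add0r lerD// -[leLHS]expR0 ler_expR; lra.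
  move=> big.
  (* Inverse of a lower bound on the length of column [k], so that the rescaled column [a] has
     length at least 1. *)
  pose lam := (L / 2 * sqn)^-1.
  have lam0 : 0 < lam by rewrite invr_gt0 mulr_gt0// divr_gt0.
  pose a i := lam * Z (i, k) w1.
  have a1 : 1 <= \sum_i a i ^+ 2.
    (* Summing [(|z| - L/2)^2 >= 0] converts the [l^1] bound [L n / 2] into the squared length bound
       [(L/2)^2 n]. *)
    have : \sum_i (L * `|Z (i, k) w1| - (L / 2) ^+ 2) <= \sum_i Z (i, k) w1 ^+ 2.
      apply: ler_sum => i _; have := sqr_ge0 (`|Z (i, k) w1| - L / 2).
      rewrite sqrrB real_normK ?num_real//; lra.
    rewrite sumrB -mulr_sumr sumr_const card_ord -mulr_natr.
    under [X in 1 <= X]eq_bigr => i _ do rewrite /a exprMn.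
    have -> : lam ^+ 2 = ((L / 2) ^+ 2 * n%:R)^-1.
      by rewrite /lam -sqnE; field; rewrite !gt_eqF.
    rewrite -mulr_sumr => H.
    have n0R : 0 < n%:R :> R by rewrite ltr0n.
    rewrite mulrC ler_pdivlMr ?mulr_gt0 ?exprn_gt0 ?divr_gt0// mul1r.
    nra.
  have mexp : measurable_fun setT (fun w2 =>
      (expR (- \sum_(j | j != k) `|\sum_i a i * Z (i, j) w2|))%:E : \bar R).
    apply/measurable_EFinP; apply: measurableT_comp => //.
    apply: measurableT_comp => //.
    under [X in measurable_fun _ X]eq_fun do rewrite -big_filter.
    apply: measurable_sum => j; apply: measurableT_comp => //.
    by apply: measurable_sum => i; apply: measurable_funM.
  (* Chernoff: [1_(G < thr) <= e^(lam (thr - G))], with [lam thr = L p / 2] *)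
  have step (w2 : T) : (F (splice Z K (w1, w2)) <= (expR (L / 2 * p%:R))%:E *
      (expR (- \sum_(j | j != k) `|\sum_i a i * Z (i, j) w2|))%:E)%E.
    rewrite -EFinM -expRD lee_fin indicE.
    case: (boolP (_ \in B)) => [|_]; last exact: expR_ge0.
    rewrite inE /B /= => GB; rewrite -[leLHS]expR0 ler_expR subr_ge0.
    have -> : L / 2 * p%:R = lam * thr.
      by rewrite /lam /thr; field; rewrite !gt_eqF.
    have -> : \sum_(j | j != k) `|\sum_i a i * Z (i, j) w2| =
        lam * G (splice Z K (w1, w2)).
      rewrite /G mulr_sumr; apply: eq_bigr => j jk.
      rewrite -[X in X * `|_|](gtr0_norm lam0) -normrM mulr_sumr.
      congr `|_|; apply: eq_bigr => i _.
      by rewrite /splice /= eqxx (negbTE jk) mulrA.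
    by rewrite ler_pM2l// ltW.
  apply: (@le_trans _ _ (\int[P]_w2 ((expR (L / 2 * p%:R))%:E *
      (expR (- \sum_(j | j != k) `|\sum_i a i * Z (i, j) w2|))%:E))%E).
    apply: ge0_le_integral => //.
    exact: measurable_funeM.
  rewrite ge0_integralZl_EFin ?expR_ge0//.
  apply: (@le_trans _ _ ((expR (L / 2 * p%:R))%:E * (laplace_bound ^+ p.-1)%:E)%E).
    apply: lee_wpmul2l; first by rewrite lee_fin expR_ge0.
    exact: integral_expRN_other_columns.
  rewrite -EFinM lee_fin LE -expRM_natl -expRD.
  rewrite -[leLHS]addr0; apply: lerD; last exact: expR_ge0.
  (* The absent column [k] leaves a factor [e^L], absorbed by the 2 in [C]. *)
  have -> : L / 2 * p%:R + p.-1%:R * - L = L + - (L / 2 * p%:R).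
    have p0 : (0 < p)%N by apply: leq_trans (ltn_ord k).
    have -> : p%:R = p.-1%:R + 1 :> R by rewrite natr1 prednK.
    by field.
  by rewrite expRD /C ler_wpM2r ?expR_ge0.
apply: (@le_trans _ _ (\int[P]_w1 (C%:E + (small w1)%:E))%E).
  apply: ge0_le_integral => //.
  - by move=> w _; apply: integral_ge0.
  - exact: (measurable_fun_fubini_tonelli_F _ mFs
      (fun z => F0 (splice Z K z))).
  - by apply: emeasurable_funD.
have sm0 (w : T) : [set: T] w -> (0 <= (small w)%:E)%E by rewrite lee_fin expR_ge0.
have C0' (w : T) : [set: T] w -> (0 <= C%:E)%E by rewrite lee_fin.
rewrite (ge0_integralD P measurableT C0' (measurable_cst _) sm0 msmall).
rewrite integral_cst// [X in (_ * X + _)%E]probability_setT mule1.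
rewrite [leRHS]EFinD; apply: leeD => //.
have E1 : (\int[P]_w (small w)%:E = (expR (L / 2 * n%:R))%:E *
    \int[P]_w (expR (- \sum_i `|Z (i, k) w|))%:E)%E.
  have mE : measurable_fun setT
      (fun w => (expR (- \sum_i `|Z (i, k) w|))%:E : \bar R).
    apply/measurable_EFinP; apply: measurableT_comp => //.
    apply: measurableT_comp => //; apply: measurable_sum => i.
    exact: measurableT_comp.
  rewrite -ge0_integralZl_EFin ?expR_ge0//.
  by apply: eq_integral => w _; rewrite -EFinM -expRD.
rewrite E1.
apply: (@le_trans _ _ ((expR (L / 2 * n%:R))%:E * (laplace_bound ^+ n)%:E)%E).
  by apply: lee_wpmul2l; [rewrite lee_fin expR_ge0|exact: integral_expRN_column].
rewrite -EFinM lee_fin LE -expRM_natl -expRD ler_expR.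
lra.
Qed.

End gram.

(** * Determinants and positive semidefinite forms *)


Section linear_algebra.

(** Sylvester's identity: factor the block matrix with rows [(1, -A)] and [(B, 1)] into triangular
    ones in two ways. *)
Lemma det_add1_mulmx (R : comNzRingType) (m n : nat) (A : 'M[R]_(m, n))
    (B : 'M[R]_(n, m)) : \det (1%:M + A *m B) = \det (1%:M + B *m A).
Proof.
pose M : 'M[R]_(m + n) := block_mx 1%:M (- A) B 1%:M.
have E1 : M = block_mx 1%:M 0 B 1%:M *m block_mx 1%:M (- A) 0 (1%:M + B *m A).
  rewrite mulmx_block ?(mul1mx, mul0mx, mulmx1, mulmx0, addr0) mulmxN.
  by rewrite /M; congr block_mx; rewrite addrCA addNr addr0.
have E2 : M = block_mx (1%:M + A *m B) (- A) 0 1%:M *m block_mx 1%:M 0 B 1%:M.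
  rewrite mulmx_block ?(mul1mx, mul0mx, mulmx1, mulmx0, add0r) mulNmx.
  by rewrite /M; congr block_mx; rewrite addrK.
have := congr1 determinant E1; rewrite E2 !det_mulmx !det_ublock !det_lblock.
by rewrite !det1 !mulr1 !mul1r.
Qed.

(** Matrix determinant lemma: after factoring out [A], Sylvester's identity leaves a determinant of
    size one. *)
Lemma det_add_rank1 (R : comUnitRingType) (n : nat) (A : 'M[R]_n) (u : 'cV[R]_n)
    (s : R) : A \in unitmx ->
  \det (A + s *: (u *m u^T)) =
  \det A * (1 + s * (u^T *m invmx A *m u) 0 0).
Proof.
move=> uA.
have -> : A + s *: (u *m u^T) = A *m (1%:M + (s *: (invmx A *m u)) *m u^T).
  by rewrite mulmxDr mulmx1 -scalemxAl -scalemxAr !mulmxA mulmxV// mul1mx.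
rewrite det_mulmx det_add1_mulmx det_mx11 -scalemxAr mulmxA; congr (_ * _).
by set w := u^T *m _ *m u; rewrite !mxE.
Qed.

Definition bilin (R : pzRingType) (n : nat) (A : 'M[R]_n) (x y : 'cV[R]_n) : R :=
  (x^T *m A *m y) 0 0.

Definition psd (R : numDomainType) (n : nat) (A : 'M[R]_n) :=
  forall x : 'cV[R]_n, 0 <= bilin A x x.

Lemma bilinDl (R : pzRingType) (n : nat) (A : 'M[R]_n) x y z :
  bilin A (x + y) z = bilin A x z + bilin A y z.
Proof. by rewrite /bilin linearD/= !mulmxDl mxE. Qed.

Lemma bilinDr (R : pzRingType) (n : nat) (A : 'M[R]_n) x y z :
  bilin A z (x + y) = bilin A z x + bilin A z y.
Proof. by rewrite /bilin mulmxDr mxE. Qed.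

Lemma bilinZl (R : comPzRingType) (n : nat) (A : 'M[R]_n) c x y :
  bilin A (c *: x) y = c * bilin A x y.
Proof. by rewrite /bilin linearZ/= -!scalemxAl mxE. Qed.

Lemma bilinZr (R : comPzRingType) (n : nat) (A : 'M[R]_n) c x y :
  bilin A x (c *: y) = c * bilin A x y.
Proof. by rewrite /bilin -scalemxAr mxE. Qed.

Lemma bilinE (R : comPzRingType) (n : nat) (A : 'M[R]_n) x y :
  bilin A x y = \sum_i \sum_j x i 0 * A i j * y j 0.
Proof.
rewrite /bilin -mulmxA mxE; apply: eq_bigr => i _; rewrite !mxE mulr_sumr.
by apply: eq_bigr => j _; rewrite mulrA.
Qed.

Lemma bilinC (R : comPzRingType) (n : nat) (A : 'M[R]_n) x y :
  A^T = A -> bilin A x y = bilin A y x.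
Proof.
move=> symA; rewrite !bilinE exchange_big; apply: eq_bigr => i _.
apply: eq_bigr => j _; rewrite -[in LHS]symA mxE.
by rewrite mulrC mulrA -mulrA [X in _ * X]mulrC mulrA.
Qed.

Lemma bilin_delta (R : comPzRingType) (n : nat) (A : 'M[R]_n) j k :
  bilin A (delta_mx j 0) (delta_mx k 0) = A j k.
Proof. by rewrite /bilin trmx_delta -rowE -colE !mxE. Qed.

Section positive.
Context {R : realType}.
Implicit Types (n : nat).

Lemma bilin1_gt0 n (x : 'cV[R]_n) : x != 0 -> 0 < (x^T *m x) 0 0.
Proof.
move=> x0; rewrite mxE lt_neqAle; apply/andP; split; last first.
  by apply: sumr_ge0 => i _; rewrite mxE -expr2 sqr_ge0.
rewrite eq_sym psumr_eq0; last by move=> i _; rewrite mxE -expr2 sqr_ge0.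
apply: contra x0 => /allP x0; apply/eqP/colP => i; apply/eqP.
by have := x0 i (mem_index_enum i); rewrite mxE mulf_eq0 orbb mxE.
Qed.

Lemma bilin_sub_sqr n (A : 'M[R]_n) x y (s : R) : A^T = A ->
  bilin A (x - s *: y) (x - s *: y) =
  bilin A x x - 2 * s * bilin A x y + s ^+ 2 * bilin A y y.
Proof.
move=> symA; rewrite -scaleNr !(bilinDl, bilinDr, bilinZl, bilinZr).
by rewrite (bilinC y x symA); ring.
Qed.

(** If [y = A x] were nonzero, moving from [x] along [- y] would decrease the form linearly and
    increase it only quadratically. The step [|y|^2 / (q + 1)] makes it negative. *)
Lemma psd_null n (A : 'M[R]_n) x :
  A^T = A -> psd A -> bilin A x x = 0 -> A *m x = 0.
Proof.
move=> symA pA x0; apply/eqP; apply/negP => /negP Ax0.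
have := bilin1_gt0 Ax0; set y := A *m x => y0.
have xy : bilin A x y = (y^T *m y) 0 0.
  by rewrite (bilinC _ _ symA) /bilin -mulmxA.
set q := bilin A y y; have q0 : 0 <= q := pA y.
have := pA (x - ((y^T *m y) 0 0 / (q + 1)) *: y).
rewrite (bilin_sub_sqr _ _ _ symA) x0 xy -/q; set r := (y^T *m y) 0 0 in y0 *.
have -> : 0 - 2 * (r / (q + 1)) * r + (r / (q + 1)) ^+ 2 * q =
    - (r / (q + 1)) ^+ 2 * (q + 2).
  by field; rewrite gt_eqF// ltr_wpDl.
have := divr_gt0 y0 (ltr_wpDl q0 ltr01 : 0 < q + 1).
set t := r / _ => t0.
by rewrite mulNr oppr_ge0 leNgt mulr_gt0 ?exprn_gt0// ltr_wpDl.
Qed.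

(** Along the segment from the identity to [A] the determinant is a polynomial starting at 1. A root
    before the endpoint would give a kernel vector of a matrix with positive form; at the endpoint,
    invertibility excludes it. *)
Lemma psd_det_gt0 n (A : 'M[R]_n) : psd A -> A \in unitmx -> 0 < \det A.
Proof.
move=> pA uA.
pose p : {poly R} := \det (map_mx polyC 1%:M + 'X *: map_mx polyC (A - 1%:M)).
have pE t : p.[t] = \det (1%:M + t *: (A - 1%:M)).
  rewrite /p -horner_evalE -det_map_mx; congr (\det _); apply/matrixP => i j.
  by rewrite !mxE /= horner_evalE !hornerE.
have p0 : p.[0] = 1 by rewrite pE scale0r addr0 det1.
have p1 : p.[1] = \det A by rewrite pE scale1r addrC subrK.
have dA : \det A != 0 by rewrite -unitfE -unitmxE.
rewrite ltNge; apply/negP => dA0.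
have [t /andP[t0 t1] /rootP] : exists2 t, 0 <= t <= 1 & root (- p) t.
  by apply: poly_ivt => //; rewrite !hornerN p0 p1; apply/andP; split; lra.
rewrite hornerN => /eqP; rewrite oppr_eq0 pE => /det0P[v v0].
have [tE|t1'] := eqVneq t 1.
  move=> vA; have : \det A == 0; last by rewrite (negbTE dA).
  by apply/det0P; exists v => //; move: vA; rewrite tE scale1r addrC subrK.
move=> /(congr1 (fun w => (w *m v^T) 0 0)).
rewrite mul0mx [RHS]mxE => /eqP; apply/negP; rewrite gt_eqF//.
have -> : 1%:M + t *: (A - 1%:M) = (1 - t) *: 1%:M + t *: A.
  by rewrite scalerBr scalerBl scale1r addrCA addrC.
rewrite mulmxDr -!scalemxAr mulmx1 mulmxDl -!scalemxAl mxE [X in X + _]mxE [X in _ + X]mxE.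
apply: ltr_wpDr.
  by apply: mulr_ge0 => //; have := pA v^T; rewrite /bilin trmxK.
apply: mulr_gt0; first by rewrite subr_gt0 lt_neqAle t1' t1.
by rewrite -{1}[v]trmxK; apply: bilin1_gt0; rewrite trmx_eq0.
Qed.

End positive.
End linear_algebra.

(** * The minimizer and its loss *)


Section minimizer.
Context {R : realType} {p : nat}.
Implicit Types (S Theta : 'M[R]_p) (u x : 'cV[R]_p).

Lemma ln_ge1Bx (y : R) : 0 < y -> 1 - y^-1 <= ln y.
Proof.
move=> y0; have := @le_ln1Dx R (y^-1 - 1).
rewrite (addrC 1) subrK lnV ?posrE// => H.
have : -1 < y^-1 - 1 by rewrite ltrBrDl subrr invr_gt0.
by move=> /H; lra.
Qed.

(** The last hypothesis gives [q - a <= s a q <= s q^2], while [s] is chosen so that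
    [s q^2 < q - a]. *)
Lemma perturb_up_absurd (a q s : R) : 0 <= q -> a < q -> 0 < s ->
  s * (2 * (q ^+ 2 + 1)) = q - a -> q <= a * (1 + s * q) -> False.
Proof.
move=> q0 aq s0 sE H.
have : 0 <= (q - a) * (s * q).
  by apply: mulr_ge0; [rewrite subr_ge0 ltW|rewrite mulr_ge0// ltW].
nra.
Qed.

(** Here [a - q <= s a q], while [s] is chosen so that [s a q < a - q]. *)
Lemma perturb_down_absurd (a q s : R) : 0 < s -> q < a -> 0 <= a * q ->
  s * (2 * (a * q + 1)) <= a - q -> a * (1 - s * q) <= q -> False.
Proof. move=> s0 qa aq0 s2 H; nra. Qed.

Lemma bilin_inner_mx S u : inner_mx (u *m u^T) S = bilin S u u.
Proof.
rewrite /inner_mx trmx_mul trmxK -mulmxA mxtrace_mulC.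
by rewrite /mxtrace big_ord1 /bilin.
Qed.

Lemma bilin_rank1 u x : bilin (u *m u^T) x x = ((x^T *m u) 0 0) ^+ 2.
Proof.
rewrite /bilin mulmxA -mulmxA; set a := x^T *m u.
have -> : u^T *m x = a^T by rewrite trmx_mul trmxK.
by rewrite mxE big_ord1 [a^T _ _]mxE expr2.
Qed.

Lemma rank1E u j k : (u *m u^T) j k = u j 0 * u k 0.
Proof. by rewrite mxE big_ord1 [u^T _ _]mxE. Qed.

Lemma bilin_add_rank1 S u x (s : R) : bilin (S + s *: (u *m u^T)) x x =
  bilin S x x + s * ((x^T *m u) 0 0) ^+ 2.
Proof.
by rewrite -bilin_rank1 /bilin mulmxDr mulmxDl -scalemxAr -scalemxAl mxE
  [X in _ + X]mxE.
Qed.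

Lemma M_matrices1 : M_matrices (1%:M : 'M[R]_p).
Proof.
split; first by rewrite trmx1.
  move=> x; rewrite mulmx1; have [->|x0] := eqVneq x 0.
    by rewrite mulmx0 mxE.
  by rewrite ltW// bilin1_gt0.
by move=> j k jk; rewrite mxE (negbTE jk).
Qed.

Section argmin.
Variables S Theta : 'M[R]_p.
Hypothesis minTheta : is_argmin M_matrices (stein_objective S) Theta.

Let MTheta : M_matrices Theta := proj1 minTheta.

Lemma argmin_sym : Theta^T = Theta. Proof. by case: MTheta. Qed.

Lemma argmin_psd : psd Theta. Proof. by case: MTheta. Qed.

(** A singular matrix has infinite objective, whereas the identity is feasible with a finite one. *)
Lemma argmin_unitmx : Theta \in unitmx.
Proof.
have := (proj2 minTheta) _ M_matrices1.
rewrite /stein_objective /neg_log_det unitmx1; case: ifP => //.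
Qed.

Let Sigma := invmx Theta.

Lemma argmin_inv_sym : Sigma^T = Sigma.
Proof. by rewrite /Sigma trmx_inv argmin_sym. Qed.

Lemma bilin_invmx u : bilin Sigma u u = bilin Theta (Sigma *m u) (Sigma *m u).
Proof.
rewrite /bilin trmx_mul argmin_inv_sym -!mulmxA.
by rewrite (mulmxA Theta) mulmxV ?argmin_unitmx// mul1mx.
Qed.

Lemma bilin_invmx_ge0 u : 0 <= bilin Sigma u u.
Proof. by rewrite bilin_invmx; exact: argmin_psd. Qed.

(** By the determinant lemma, the objective changes by [s u^T S u - ln (1 + s u^T Sigma u)], which
    minimality makes nonnegative. *)
Lemma argmin_perturb u (s : R) : 0 < 1 + s * bilin Sigma u u ->
  M_matrices (Theta + s *: (u *m u^T)) ->
  ln (1 + s * bilin Sigma u u) <= s * bilin S u u.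
Proof.
move=> q0 /(proj2 minTheta).
have uT := argmin_unitmx.
have dT := psd_det_gt0 argmin_psd uT.
have dE := det_add_rank1 u s uT; rewrite -/(bilin _ u u) -/Sigma in dE.
have uT' : Theta + s *: (u *m u^T) \in unitmx.
  by rewrite unitmxE unitfE dE mulf_neq0 ?gt_eqF.
rewrite /stein_objective /neg_log_det uT uT' dE lnM ?posrE//.
have -> : inner_mx (Theta + s *: (u *m u^T)) S =
    inner_mx Theta S + s * bilin S u u.
  rewrite -bilin_inner_mx /inner_mx linearD/= linearZ/= mulmxDl -scalemxAl.
  by rewrite linearD/= linearZ.
rewrite -!EFinD lee_fin; clear; lra.
Qed.

(** First-order condition in a feasible direction, obtained from one explicit small step and
    [ln y >= 1 - 1/y] instead of a derivative. *)
Lemma argmin_ge u : (forall s, 0 < s -> M_matrices (Theta + s *: (u *m u^T))) ->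
  bilin Sigma u u <= bilin S u u.
Proof.
move=> MT; set q := bilin Sigma u u; set a := bilin S u u.
have q0 : 0 <= q := bilin_invmx_ge0 u.
rewrite leNgt; apply/negP => aq.
pose s := (q - a) / (2 * (q ^+ 2 + 1)).
have d0 : 0 < 2 * (q ^+ 2 + 1) by rewrite mulr_gt0// ltr_wpDl ?sqr_ge0.
have s0 : 0 < s by rewrite divr_gt0// subr_gt0.
have sE : s * (2 * (q ^+ 2 + 1)) = q - a by rewrite /s divfK// gt_eqF.
have y0 : 0 < 1 + s * q by rewrite ltr_pwDl// mulr_ge0// ltW.
have := argmin_perturb y0 (MT s s0); rewrite -/q -/a => H1.
have := le_trans (ln_ge1Bx y0) H1.
have -> : 1 - (1 + s * q)^-1 = s * q / (1 + s * q) by field; rewrite gt_eqF.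
rewrite ler_pdivrMr// -(mulrA s a) ler_pM2l//.
exact: perturb_up_absurd.
Qed.

(** With [c = x^T u], positivity of [Theta] at [x - s c Sigma u] gives
    [x^T Theta x - s c^2 >= s c^2 (1 - s q)]. *)
Lemma psd_sub_rank1 u (s : R) : 0 <= s -> s * bilin Sigma u u <= 1 ->
  psd (Theta - s *: (u *m u^T)).
Proof.
move=> s0 sq x; set q := bilin Sigma u u in sq.
pose c := (x^T *m u) 0 0.
have -> : bilin (Theta - s *: (u *m u^T)) x x = bilin Theta x x - s * c ^+ 2.
  by rewrite -scaleNr bilin_add_rank1 mulNr.
have := argmin_psd (x - (s * c) *: (Sigma *m u)).
rewrite bilin_sub_sqr ?argmin_sym// -bilin_invmx -/q.
have -> : bilin Theta x (Sigma *m u) = c.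
  by rewrite /bilin -mulmxA (mulmxA Theta) mulmxV ?argmin_unitmx// mul1mx.
have : 0 <= s * c ^+ 2 * (1 - s * q).
  by apply: mulr_ge0; rewrite ?subr_ge0// mulr_ge0 ?sqr_ge0.
clear; lra.
Qed.

Lemma argmin_le u :
  (forall s, 0 <= s -> s * bilin Sigma u u <= 1 ->
     M_matrices (Theta - s *: (u *m u^T))) ->
  bilin S u u <= bilin Sigma u u.
Proof.
move=> MT; set q := bilin Sigma u u; set a := bilin S u u.
have q0 : 0 <= q := bilin_invmx_ge0 u.
rewrite leNgt; apply/negP => qa.
(* The first bound gives [s q < 1], for feasibility and a positive argument of [ln]; the second
   makes the quadratic error smaller than the gap [a - q]. *)
pose s := Num.min (q + 1)^-1 ((a - q) / (2 * (a * q + 1))).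
have aq0 : 0 <= a * q by rewrite mulr_ge0// ltW// (le_lt_trans q0).
have d0 : 0 < 2 * (a * q + 1) by rewrite mulr_gt0// ltr_wpDl.
have q1 : 0 < q + 1 by rewrite ltr_wpDl.
have s0 : 0 < s by rewrite lt_min invr_gt0 q1 divr_gt0// subr_gt0.
have s1 : s * (q + 1) <= 1 by rewrite -ler_pdivlMr// div1r ge_min lexx.
have s2 : s * (2 * (a * q + 1)) <= a - q.
  by rewrite -ler_pdivlMr// ge_min lexx orbT.
have sq1 : s * q < 1 by clear -s1 s0; lra.
have y0 : 0 < 1 + - s * q by rewrite mulNr subr_gt0.
have := argmin_perturb y0; rewrite scaleNr => /(_ (MT s (ltW s0) (ltW sq1))).
rewrite -/q -/a => H1; have := le_trans (ln_ge1Bx y0) H1.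
have -> : 1 - (1 + - s * q)^-1 = - (s * q) / (1 + - s * q).
  by field; rewrite gt_eqF// -mulNr.
rewrite ler_pdivrMr// !mulNr lerN2 -(mulrA s a) ler_pM2l//.
exact: perturb_down_absurd.
Qed.

(** Lowering a diagonal entry does not touch the sign constraints, so the downward direction is
    feasible. *)
Lemma argmin_diag_ge j : S j j <= Sigma j j.
Proof.
rewrite -!bilin_delta; apply: argmin_le => s s0 sq.
split.
- rewrite linearB/= linearZ/= trmx_mul trmxK argmin_sym//.
- exact: psd_sub_rank1.
- move=> k l kl; rewrite mxE [X in _ + X]mxE [X in - X]mxE rank1E.
  have [_ _ /(_ k l kl)] := MTheta.
  rewrite [delta_mx _ _ k _]mxE [delta_mx _ _ l _]mxE !andbT.
  have [kj|_] := eqVneq k j; last by rewrite mul0r mulr0 subr0.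
  by rewrite -kj eq_sym (negbTE kl) !mulr0 subr0.
Qed.

(** Adding a multiple of [u u^T] with [u = e_j - e_k] only lowers off-diagonal entries, so
    [u^T Sigma u <= u^T S u]. Subtracting this from the two diagonal inequalities leaves twice the
    claim. *)
Lemma argmin_offdiag_ge j k : S^T = S -> S j k <= Sigma j k.
Proof.
move=> symS; have [<-|jk] := eqVneq j k; first exact: argmin_diag_ge.
pose u : 'cV[R]_p := delta_mx j 0 - delta_mx k 0.
have bE (A : 'M[R]_p) : A^T = A ->
    bilin A u u = A j j + A k k - 2 * A j k.
  move=> symA; rewrite /u -[delta_mx k 0]scale1r bilin_sub_sqr//.
  rewrite !bilin_delta; ring.
suff : bilin Sigma u u <= bilin S u u.
  rewrite (bE _ argmin_inv_sym) (bE _ symS).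
  have := argmin_diag_ge j; have := argmin_diag_ge k; clear; lra.
apply: argmin_ge => s s0; split.
- by rewrite linearD/= linearZ/= trmx_mul trmxK argmin_sym.
- move=> x; rewrite -/(bilin _ x x).
  rewrite bilin_add_rank1.
  by rewrite addr_ge0 ?argmin_psd// mulr_ge0 ?sqr_ge0// ltW.
- move=> l m lm; rewrite mxE [X in _ + X]mxE rank1E.
  have [_ _ /(_ l m lm)] := MTheta => T0.
  rewrite -[leRHS]addr0; apply: lerD => //.
  apply: mulr_ge0_le0; first exact: ltW.
  have uE i : u i 0 = (i == j)%:R - (i == k)%:R.
    by rewrite mxE [X in _ + X]mxE !mxE !andbT.
  rewrite !uE; have [lj|lj] := eqVneq l j.
    rewrite lj (negbTE jk) subr0 mul1r -lj eq_sym (negbTE lm) sub0r oppr_le0.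
    exact: ler0n.
  have [lk|lk] := eqVneq l k; last by rewrite subr0 mul0r.
  rewrite -lk [m == l]eq_sym (negbTE lm) sub0r mulN1r subr0 oppr_le0.
  exact: ler0n.
Qed.

(** Split column [k] of [Sigma] as [z = y - w] into positive and negative parts. Then
    [w^T Theta z = w_k >= 0], and [w^T Theta y <= 0] because the supports are disjoint. Hence
    [w^T Theta w <= 0], which forces [w = 0]. *)
Lemma argmin_inv_ge0 j k : 0 <= Sigma j k.
Proof.
pose z := Sigma *m delta_mx k 0 : 'cV[R]_p.
pose w : 'cV[R]_p := \col_i Num.max (- z i 0) 0.
pose y : 'cV[R]_p := \col_i Num.max (z i 0) 0.
have zE : z = y - 1 *: w.
  apply/colP => i; rewrite scale1r [RHS]mxE [X in _ + X]mxE [y _ _]mxE.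
  rewrite [w _ _]mxE; have [zi|zi] := leP 0 (z i 0).
    by rewrite max_r ?subr0// oppr_le0.
  by rewrite max_l ?oppr_ge0 ?(ltW zi)// sub0r opprK.
have Tz : Theta *m z = delta_mx k 0.
  by rewrite /z mulmxA mulmxV ?mul1mx// argmin_unitmx.
have wz : 0 <= bilin Theta w z.
  rewrite /bilin -mulmxA Tz -colE mxE [w^T _ _]mxE [w _ _]mxE.
  by rewrite le_max lexx orbT.
have wy : bilin Theta w y <= 0.
  rewrite bilinE; apply: sumr_le0 => i _; apply: sumr_le0 => l _.
  rewrite [w _ _]mxE [y _ _]mxE; have [->|il] := eqVneq i l.
    have [zl|zl] := leP (z l 0) 0; first by rewrite mulr0.
    by rewrite max_r ?mul0r// oppr_le0 ltW.
  have [_ _ /(_ i l il)] := MTheta => T0.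
  rewrite -mulrA mulr_ge0_le0 ?le_max ?lexx ?orbT//.
  by rewrite mulr_le0_ge0// le_max lexx orbT.
have ww : bilin Theta w w = 0.
  apply/eqP; rewrite eq_le argmin_psd andbT.
  have : bilin Theta w z = bilin Theta w y - bilin Theta w w.
    by rewrite zE scale1r bilinDr -scaleN1r bilinZr mulN1r.
  move: wz wy; clear; lra.
have := psd_null argmin_sym argmin_psd ww => /(congr1 (mulmx Sigma)).
rewrite mulmxA mulVmx ?argmin_unitmx// mul1mx mulmx0 => w0.
have : w j 0 = 0 by rewrite w0 mxE.
have -> : Sigma j k = z j 0 by rewrite /z -colE mxE.
rewrite [w _ _]mxE => H; have : - z j 0 <= 0 by rewrite -[leRHS]H le_max lexx.
by rewrite oppr_le0.
Qed.

End argmin.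
End minimizer.

(** Positivity at [e_j - e_k] bounds each entry by the mean of two diagonal ones. *)
Lemma sum_entries_le_mxtrace (R : realType) (p : nat) (M : 'M[R]_p) :
  M^T = M -> psd M -> \sum_j \sum_k M j k <= p%:R * \tr M.
Proof.
move=> symM pM.
have H j k : M j k <= (M j j + M k k) / 2.
  have := pM (delta_mx j 0 - 1 *: delta_mx k 0).
  rewrite bilin_sub_sqr// !bilin_delta; clear; lra.
apply: (@le_trans _ _ (\sum_j \sum_k (M j j + M k k) / 2)).
  by apply: ler_sum => j _; apply: ler_sum => k _.
rewrite le_eqVlt; apply/orP; left; apply/eqP.
under eq_bigr do rewrite -mulr_suml big_split/= sumr_const card_ord.
rewrite -mulr_suml big_split/= sumr_const card_ord sumrMnl -mulr2n.
have E (t : R) : (t *+ p) *+ 2 / 2 = p%:R * t.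
  by rewrite -(mulr_natl t p) -(mulr_natr (p%:R * t) 2) mulfK ?pnatr_eq0.
exact: E.
Qed.

Lemma L_ssym_ge (R : realType) (p : nat) (Theta Theta_star : 'M[R]_p) :
  (0 < p)%N -> Theta^T = Theta -> psd Theta -> Theta \in unitmx ->
  is_diag_mx Theta_star -> (forall j, 0 < Theta_star j j) ->
  (2 * p%:R)^-1 * (p%:R^-1 * (\sum_j \sum_k
    Num.sqrt (Theta_star j j) * Num.sqrt (Theta_star k k) * invmx Theta j k)
    - 2) <= L_ssym Theta Theta_star.
Proof.
move=> p0 symT pT uT /is_diag_mxP dT0 dT.
have p0R : 0 < p%:R :> R by rewrite ltr0n.
pose h j := Num.sqrt (Theta_star j j).
have h0 j : 0 < h j by rewrite sqrtr_gt0.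
pose H : 'M[R]_p := diag_mx (\row_j h j).
pose Hi : 'M[R]_p := diag_mx (\row_j (h j)^-1).
have HH : H *m H = Theta_star.
  apply/matrixP => i j; rewrite mul_diag_mx !mxE.
  have [->|ij] := eqVneq i j; last by rewrite dT0// mulr0n mulr0.
  by rewrite mulr1n -expr2 sqr_sqrtr// ltW.
have HHi : H *m Hi = 1%:M.
  apply/matrixP => i j; rewrite mul_diag_mx !mxE.
  by have [->|ij] := eqVneq i j; rewrite ?mulr0n ?mulr0// mulr1n mulfV ?gt_eqF.
have HiH : Hi *m H = 1%:M by exact: mulmx1C.
have HiHi : invmx Theta_star = Hi *m Hi.
  have uS : Theta_star \in unitmx.
    by rewrite -HH unitmx_mul; have [-> _] := mulmx1_unit HHi.
  apply: (can_inj (mulKmx uS)); rewrite mulmxV//.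
  by rewrite -HH mulmxA -(mulmxA H) HHi mulmx1 HHi.
have HT : H^T = H by rewrite tr_diag_mx.
have HiT : Hi^T = Hi by rewrite tr_diag_mx.
set Sigma := invmx Theta.
have SigmaT : Sigma^T = Sigma by rewrite /Sigma trmx_inv symT.
(* With [T = Hi Theta Hi], the matrix [M] is [(T^-1 - I) T (T^-1 - I) = T + T^-1 - 2 I]: positivity
   is visible without a square root of [Theta]. *)
pose A := Sigma *m H - Hi.
pose M := A^T *m Theta *m A.
have ME : M = H *m Sigma *m H + Hi *m Theta *m Hi - 1%:M - 1%:M.
  have AT : A^T = H *m Sigma - Hi by rewrite /A linearB/= trmx_mul HT HiT SigmaT.
  rewrite /M AT /A !mulmxBl !mulmxBr.
  have -> : H *m Sigma *m Theta *m (Sigma *m H) = H *m Sigma *m H.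
    by rewrite -!mulmxA (mulmxA Theta) mulmxV// mul1mx.
  have -> : H *m Sigma *m Theta *m Hi = 1%:M.
    by rewrite -(mulmxA H) mulVmx// mulmx1.
  have -> : Hi *m Theta *m (Sigma *m H) = 1%:M.
    by rewrite -!mulmxA (mulmxA Theta) mulmxV// mul1mx.
  by rewrite opprB addrA; congr (_ - _); rewrite addrAC.
have bM x : bilin M x x = bilin Theta (A *m x) (A *m x).
  by rewrite /bilin /M trmx_mul !mulmxA.
have pM : psd M by move=> x; rewrite bM.
have symM : M^T = M by rewrite /M !trmx_mul trmxK symT mulmxA.
have LE : L_ssym Theta Theta_star = (2 * p%:R)^-1 * \tr M.
  rewrite /L_ssym /inner_mx; congr (_ * _).
  have symD : Theta_star^T = Theta_star by rewrite -HH trmx_mul HT.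
  have -> : (Theta - Theta_star)^T = Theta - Theta_star.
    by rewrite linearB/= symT symD.
  rewrite mulmxBl !mulmxBr mulmxV//.
  have -> : Theta_star *m invmx Theta_star = 1%:M.
    by rewrite HiHi -HH mulmxA -(mulmxA H) HHi mulmx1 HHi.
  rewrite ME !linearB/= !linearD/=.
  rewrite -[\tr (H *m Sigma *m H)]mxtrace_mulC mulmxA HH.
  rewrite -[\tr (Hi *m Theta *m Hi)]mxtrace_mulC mulmxA -HiHi.
  rewrite [\tr (invmx _ *m _)]mxtrace_mulC -/Sigma; clear; ring.
rewrite LE ler_pM2l; last by rewrite invr_gt0 mulr_gt0.
rewrite lerBlDr mulrC ler_pdivrMr//.
have := sum_entries_le_mxtrace symM pM.
have -> : \sum_j \sum_k M j k = \sum_j \sum_k (h j * h k * Sigma j k) +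
    bilin (Hi *m Theta *m Hi) (const_mx 1) (const_mx 1) - 2 * p%:R.
  rewrite bilinE -big_split/=.
  transitivity (\sum_j (\sum_k (h j * h k * Sigma j k +
    (const_mx 1 : 'cV[R]_p) j 0 * (Hi *m Theta *m Hi) j k *
     (const_mx 1 : 'cV[R]_p) k 0) - 2)); last first.
    rewrite sumrB sumr_const card_ord mulr_natr; congr (_ - _).
    by apply: eq_bigr => j _; rewrite big_split.
  apply: eq_bigr => j _.
  have -> : 2 = \sum_k (j == k)%:R *+ 2 :> R.
    rewrite (bigD1 j)//= eqxx big1 ?addr0// => k kj.
    by rewrite eq_sym (negbTE kj) mul0rn.
  rewrite -sumrB; apply: eq_bigr => k _.
  have -> : M j k = (H *m Sigma *m H) j k + (Hi *m Theta *m Hi) j k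
      - (1%:M : 'M[R]_p) j k *+ 2.
    rewrite ME; move: (H *m Sigma *m H) (Hi *m Theta *m Hi) => B C.
    by rewrite [LHS]mxE [X in X + _]mxE [X in X + _ + _]mxE !mxE mulr2n opprD addrA.
  rewrite [const_mx _ _ _]mxE [const_mx _ k _]mxE mul1r mulr1 [1%:M _ _]mxE.
  congr (_ + _ - _); rewrite /H mul_mx_diag mxE mul_diag_mx mxE.
  by rewrite [X in X * _ * _]mxE [X in _ * X]mxE mulrAC.
(* The contribution of the rescaled [Theta] to the sum of entries is nonnegative and is
   discarded. *)
have : 0 <= bilin (Hi *m Theta *m Hi) (const_mx 1) (const_mx 1).
  have -> : forall x, bilin (Hi *m Theta *m Hi) x x =
      bilin Theta (Hi *m x) (Hi *m x).
    by move=> x; rewrite /bilin trmx_mul HiT !mulmxA.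
  exact: pT.
rewrite -/Sigma -/h; move: (bilin _ _ _) (\tr M) (\sum_j _); clear.
move=> b t s b0 H; rewrite mulrDl mulrC; lra.
Qed.

(** * The normal distribution *)


Section density.
Context {R : realType}.
Local Notation mu := (@lebesgue_measure R).

(* Layer-cake: both sides are the double integral of the indicator of
   [{(x, y) | 0 <= y < f x}], integrated over [x] first. *)
Lemma integral_density (nu : probability (measurableTypeR R) R) (g f : R -> R) :
  measurable_fun setT g -> (forall x, 0 <= g x) ->
  measurable_fun setT f -> (forall x, 0 <= f x) ->
  (forall A : set R, measurable A ->
    nu A = (\int[mu]_x (g x * \1_A x)%:E)%E) ->
  (\int[nu]_x (f x)%:E = \int[mu]_x (g x * f x)%:E)%E.
Proof.
move=> mg g0 mf f0 nuE.
(* Written through [y] and [f x - y], the indicator is jointly measurable by composition. *)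
pose h (z : measurableTypeR R * measurableTypeR R) : R :=
  \1_(`[0, +oo[ : set R) z.2 * \1_(`]0, +oo[ : set R) (f z.1 - z.2).
have mh : measurable_fun setT h.
  apply: measurable_funM.
    apply: measurableT_comp; first exact: measurable_indic.
    exact: measurable_snd.
  apply: measurableT_comp; first exact: measurable_indic.
  apply: measurable_funB; last exact: measurable_snd.
  exact: (measurableT_comp mf measurable_fst).
have h0 z : 0 <= h z by rewrite mulr_ge0.
have hx x y : h (x, y) = \1_(`[0, f x[ : set R) y.
  rewrite /h !indicE -natrM mulnb; congr (_%:R); congr nat_of_bool.
  by rewrite !mem_setE !in_itv/= !andbT subr_gt0.
have hy x y : h (x, y) = \1_(`[0, +oo[ : set R) y * \1_[set t | y < f t] x.
  rewrite /h; congr (_ * _); rewrite !indicE; congr (_%:R); congr nat_of_bool.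
  by rewrite mem_setE in_itv/= andbT subr_gt0; apply/idP/idP; rewrite inE.
have inner x : (\int[mu]_y (h (x, y))%:E = (f x)%:E)%E.
  under eq_integral do rewrite hx.
  transitivity (lebesgue_measure (`[0, f x[ : set R)).
    by rewrite integral_indic// setIT.
  rewrite lebesgue_measure_itv/= lte_fin.
  by case: ltP => [fx|fx]; rewrite ?oppr0 ?adde0// (@le_anti _ _ (f x) 0)// fx f0.
have mlt y : measurable [set t | y < f t].
  have := mf measurableT `]y, +oo[%classic (measurable_itv _).
  rewrite setTI; congr measurable.
  by apply/seteqP; split=> t /=; rewrite in_itv/= andbT.
transitivity (\int[nu]_x \int[mu]_y (h (x, y))%:E)%E.
  by apply: eq_integral => x _; rewrite inner.
rewrite (fubini_tonelli (m1 := nu) (m2 := mu) (fun z => (h z)%:E)); last 2 first.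
  exact/measurable_EFinP.
  by move=> z; rewrite lee_fin.
transitivity (\int[mu]_y \int[mu]_x (g x * h (x, y))%:E)%E.
  apply: eq_integral => y _.
  under eq_integral do rewrite hy EFinM.
  pose A : set R := [set t | y < f t].
  have mind : measurable_fun setT
      (fun x : measurableTypeR R => (\1_A x)%:E : \bar R).
    by apply/measurable_EFinP; exact: (measurable_indic (mlt y)).
  have ind0 (x : measurableTypeR R) : [set: measurableTypeR R] x ->
      (0 <= (\1_A x)%:E :> \bar R)%E by rewrite lee_fin.
  rewrite (ge0_integralZl_EFin nu measurableT ind0 mind)//.
  have -> : (\int[nu]_x (\1_A x)%:E = nu A)%E.
    rewrite integral_indic//; last exact: (mlt y).
    by congr (nu _); rewrite setIT.
  rewrite nuE; last exact: mlt.
  have gind0 (x : measurableTypeR R) : [set: measurableTypeR R] x ->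
      (0 <= (g x * \1_A x)%:E :> \bar R)%E by rewrite lee_fin mulr_ge0.
  have mgind : measurable_fun setT
      (fun x : measurableTypeR R => (g x * \1_A x)%:E : \bar R).
    by apply/measurable_EFinP; apply: measurable_funM => //;
      exact: (measurable_indic (mlt y)).
  have k0 : 0 <= \1_(`[0, +oo[ : set R) y :> R by [].
  transitivity (\int[mu]_x ((\1_(`[0%R, +oo[ : set R) y)%:E *
      (g x * \1_A x)%:E))%E.
    exact/esym/(ge0_integralZl_EFin _ measurableT gind0 mgind k0).
  by apply: eq_integral => x _; rewrite hy -EFinM mulrCA.
rewrite -(fubini_tonelli (m1 := mu) (m2 := mu)
  (fun z : measurableTypeR R * measurableTypeR R => (g z.1 * h z)%:E)); last 2 first.
  apply/measurable_EFinP; apply: measurable_funM => //.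
  exact: (measurableT_comp mg measurable_fst).
  by move=> z; rewrite lee_fin mulr_ge0.
apply: eq_integral => x _; rewrite [RHS]EFinM -inner /=.
under eq_integral do rewrite EFinM.
rewrite ge0_integralZl_EFin//; first by move=> y _; rewrite lee_fin.
apply/measurable_EFinP; under [X in measurable_fun _ X]eq_fun do rewrite hx.
exact: measurable_indic.
Qed.

Lemma normal_prob_indic (s : R) (A : set R) : measurable A ->
  normal_prob 0 s A = (\int[mu]_x (normal_pdf 0 s x * \1_A x)%:E)%E.
Proof.
move=> mA; rewrite /normal_prob integral_mkcond; apply: eq_integral => x _.
by rewrite epatch_indic.
Qed.

(** Completing the square turns [e^(t x)] times the centered density into [e^((t s)^2 / 2)] times
    the density with mean [t s^2]. *)
Lemma normal_prob_mgf (s t : R) : 0 < s ->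
  (\int[normal_prob 0 s]_x (expR (t * x))%:E =
   (expR ((t * s) ^+ 2 / 2))%:E)%E.
Proof.
move=> s0; have sn0 : s != 0 by rewrite gt_eqF.
rewrite (integral_density (g := normal_pdf 0 s)).
- transitivity (\int[mu]_x ((expR ((t * s) ^+ 2 / 2))%:E *
    (normal_pdf (t * s ^+ 2) s x)%:E))%E.
    apply: eq_integral => x _; rewrite -EFinM !normal_pdfE// /normal_fun.
    congr _%:E; rewrite mulrCA -mulrA -!expRD; congr (_ * expR _).
    by field.
  rewrite ge0_integralZl_EFin ?expR_ge0//.
  + by rewrite integral_normal_pdf mule1.
  + by move=> x _; rewrite lee_fin normal_pdf_ge0.
  + by apply/measurable_EFinP; exact: measurable_normal_pdf.
- exact: measurable_normal_pdf.
- exact: normal_pdf_ge0.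
- by apply: measurableT_comp => //; exact: measurable_funM.
- by move=> x; exact: expR_ge0.
- exact: normal_prob_indic.
Qed.

End density.

(** * Gaussian rows with diagonal covariance *)


Section gaussian_rows.
Context {R : realType}.
Local Notation mu := (@lebesgue_measure R).

(** The constant [c] makes the induction work: once the first coordinate is fixed, its factor joins
    the constant. *)
Lemma lebesgue_tuple_integral_prod (p : nat) (c : R) (g : 'I_p -> R -> R) :
  0 <= c -> (forall j, measurable_fun setT (g j)) ->
  (forall j x, 0 <= g j x) ->
  lebesgue_tuple_integral
    (fun x : p.-tuple R => (c * \prod_j g j (tnth x j))%:E) =
  (c%:E * \prod_j \int[mu]_x (g j x)%:E)%E.
Proof.
elim: p c g => [|p IH] c g c0 mg g0 /=; first by rewrite !big_ord0 mulr1 mule1.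
have mgE : measurable_fun setT (fun x : measurableTypeR R => (g ord0 x)%:E : \bar R).
  by apply/measurable_EFinP; exact: (mg ord0).
pose K := (\prod_(j < p) \int[mu]_x (g (lift ord0 j) x)%:E)%E.
have K0 : (0 <= K)%E.
  by apply: prode_ge0 => j _; apply: integral_ge0 => x _; rewrite lee_fin.
transitivity (\int[mu]_x (c%:E * ((g ord0 x)%:E * K)))%E.
  apply: eq_integral => x _.
  rewrite muleA -EFinM -(IH _ (fun j => g (lift ord0 j))) ?mulr_ge0//.
  congr lebesgue_tuple_integral; apply/funext => t; congr _%:E.
  rewrite big_ord_recl mulrA tnth0; congr (_ * _).
  by apply: eq_bigr => j _; rewrite tnthS.
rewrite big_ord_recl -/K.
have gK0 (x : measurableTypeR R) : [set: measurableTypeR R] x ->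
    (0 <= (g ord0 x)%:E * K)%E by move=> _; rewrite mule_ge0 ?lee_fin.
have ggE0 (x : measurableTypeR R) : [set: measurableTypeR R] x ->
    (0 <= (g ord0 x)%:E)%E by rewrite lee_fin.
rewrite (ge0_integralZl_EFin _ measurableT gK0)//; last exact: emeasurable_funM.
by congr (_ * _)%E; exact: (ge0_integralZr _ measurableT mgE).
Qed.

Lemma sqrtr_prod (I : Type) (s : seq I) (a : I -> R) : (forall i, 0 <= a i) ->
  Num.sqrt (\prod_(i <- s) a i) = \prod_(i <- s) Num.sqrt (a i).
Proof.
move=> a0; elim: s => [|i s IH]; first by rewrite !big_nil sqrtr1.
by rewrite !big_cons sqrtrM// IH.
Qed.

Variables (p : nat) (Theta : 'M[R]_p).
Hypotheses (diagT : is_diag_mx Theta) (T0 : forall j, 0 < Theta j j).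

(** Standard deviation of coordinate [j] under the covariance [invmx Theta]. *)
Let sigma j := (Num.sqrt (Theta j j))^-1.

Let sigma_gt0 j : 0 < sigma j. Proof. by rewrite invr_gt0 sqrtr_gt0. Qed.

Lemma mvnormal_pdf_diag (x : p.-tuple R) :
  mvnormal_pdf 0 (invmx Theta) x =
  \prod_j normal_pdf 0 (sigma j) (tnth x j).
Proof.
have ThetaE : Theta = diag_mx (\row_j Theta j j).
  apply/matrixP => i j; rewrite !mxE.
  have [->|ij] := eqVneq i j; first by rewrite mulr1n.
  by have /is_diag_mxP -> := diagT.
have dT : \det Theta = \prod_j Theta j j.
  by rewrite ThetaE det_diag; apply: eq_bigr => j _; rewrite !mxE eqxx mulr1n.
rewrite /mvnormal_pdf invmxK det_inv dT subr0.
under [RHS]eq_bigr do rewrite normal_pdfE ?gt_eqF//.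
rewrite big_split/=; congr (_ * _).
  rewrite /normal_peak prodfV; congr (_^-1).
  rewrite -sqrtr_prod; last first.
    by move=> j; rewrite mulrn_wge0// mulr_ge0 ?sqr_ge0 ?pi_ge0.
  congr Num.sqrt; rewrite -prodfV.
  have -> : (2 * pi) ^+ p = \prod_(j < p) (2 * pi) :> R.
    by rewrite prodr_const card_ord.
  rewrite -big_split/=; apply: eq_bigr => j _.
  by rewrite /sigma exprVn sqr_sqrtr ?ltW//; ring.
rewrite /normal_fun -expR_sum; congr expR.
set y := row_of_tuple x.
have -> : (y *m Theta *m y^T) 0 0 = \sum_j Theta j j * tnth x j ^+ 2.
  rewrite ThetaE mxE; apply: eq_bigr => j _.
  rewrite mul_mx_diag !mxE eqxx mulr1n mulrAC mulrC expr2.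
  by rewrite ?mulrA.
rewrite -sumrN mulr_suml; apply: eq_bigr => j _.
rewrite subr0 /sigma exprVn sqr_sqrtr ?ltW//.
by field; rewrite gt_eqF.
Qed.

Lemma mvnormal_prob_box (A : 'I_p -> set R) : (forall j, measurable (A j)) ->
  mvnormal_prob 0 (invmx Theta) [set x | forall j, A j (tnth x j)] =
  (\prod_j normal_prob 0 (sigma j) (A j))%E.
Proof.
move=> mA; rewrite /mvnormal_prob.
transitivity (lebesgue_tuple_integral (fun x : p.-tuple R =>
    (1 * \prod_j (normal_pdf 0 (sigma j) (tnth x j) * \1_(A j) (tnth x j)))%:E)).
  congr lebesgue_tuple_integral; apply/funext => x; congr _%:E.
  rewrite mul1r mvnormal_pdf_diag big_split/=; congr (_ * _).
  rewrite indicE; case: (boolP (x \in _)) => [|/negP].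
    rewrite inE /= => xA; rewrite big1// => j _.
    by rewrite indicE mem_set.
  rewrite inE /= => /existsNP[j xj].
  by rewrite (bigD1 j)//= indicE memNset// mul0r.
rewrite (lebesgue_tuple_integral_prod
  (g := fun j t => normal_pdf 0 (sigma j) t * \1_(A j) t))//.
- by rewrite mul1e; apply: eq_bigr => j _; rewrite normal_prob_indic.
- move=> j; apply: measurable_funM; first exact: measurable_normal_pdf.
  exact: measurable_indic.
- by move=> j x; rewrite mulr_ge0// normal_pdf_ge0.
Qed.

Lemma measurable_tuple_box (A : 'I_p -> set R) : (forall j, measurable (A j)) ->
  measurable [set x : p.-tuple R | forall j, A j (tnth x j)].
Proof.
move=> mA.
have -> : [set x : p.-tuple R | forall j, A j (tnth x j)] =
    \bigcap_(j in [set: 'I_p]) ((fun x : p.-tuple R => tnth x j) @^-1` A j).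
  by apply/seteqP; split=> [x H j _|x H j]; apply: H.
apply: fin_bigcap_measurable; first exact: finite_finset.
move=> j _; rewrite -[X in measurable X]setTI.
exact: (@measurable_tnth _ _ _ j).
Qed.

Section rows.
Context {n : nat} {d} {T : measurableType d}.
Variables (P : probability T R) (X : 'I_n -> {RV P >-> p.-tuple R}).
Hypothesis indepX : mutually_independent X.
Hypothesis lawX : forall i, has_mvnormal_law (X i) 0 (invmx Theta).

Definition standardized (ij : 'I_n * 'I_p) (w : T) : R :=
  Num.sqrt (Theta ij.2 ij.2) * tnth (X ij.1 w) ij.2.

Lemma measurable_standardized ij : measurable_fun setT (standardized ij).
Proof.
apply: measurable_funM => //.
apply: (@measurableT_comp _ _ _ _ _ _ (fun x : p.-tuple R => tnth x ij.2)).
  exact: measurable_tnth.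
exact: measurable_funPT.
Qed.

Let row_box i (A : 'I_p -> set R) : (forall j, measurable (A j)) ->
  P (X i @^-1` [set x | forall j, A j (tnth x j)]) =
  (\prod_j normal_prob 0 (sigma j) (A j))%E.
Proof.
move=> mA; rewrite -mvnormal_prob_box// -(lawX i)//.
exact: measurable_tuple_box.
Qed.

Let coord_law i j (B : set R) : measurable B ->
  P ((fun w => tnth (X i w) j) @^-1` B) = normal_prob 0 (sigma j) B.
Proof.
move=> mB; pose A l := if l == j then B else setT.
have mA l : measurable (A l) by rewrite /A; case: ifP.
have -> : (fun w => tnth (X i w) j) @^-1` B =
    X i @^-1` [set x | forall l, A l (tnth x l)].
  apply/seteqP; split=> [w /= wB l|w /= /(_ j)]; last by rewrite /A eqxx.
  by rewrite /A; case: eqP => [->|].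
rewrite row_box// (bigD1 j)//= /A eqxx big1 ?mule1// => l lj.
by rewrite (negbTE lj); exact: probability_setT.
Qed.

Let msc (j : 'I_p) (B : set R) : measurable B ->
  measurable [set t : R | B (Num.sqrt (Theta j j) * t)].
Proof.
move=> mB; rewrite -[X in measurable X]setTI.
have : measurable_fun setT (fun t : R => Num.sqrt (Theta j j) * t).
  exact: measurable_funM.
by move=> /(_ measurableT B mB).
Qed.

(** Rows are independent by hypothesis; within a row, the diagonal covariance makes the law of a box
    a product. *)
Lemma standardized_independent : box_independent P standardized.
Proof.
move=> A mA.
pose B i j : set R := [set t : R | A (i, j) (Num.sqrt (Theta j j) * t)].
have mB i j : measurable (B i j) by exact: msc.
have -> : [set w | forall ij, A ij (standardized ij w)] =
    \bigcap_(i in [set` [set: 'I_n]%SET])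
      (X i @^-1` [set x | forall j, B i j (tnth x j)]).
  apply/seteqP; split=> [w /= wA i _ j|w wB [i j]]; first exact: (wA (i, j)).
  by apply: (wB i); rewrite /= inE.
rewrite indepX; last by move=> i _; exact: measurable_tuple_box.
rewrite (eq_bigr (fun ij => normal_prob 0 (sigma ij.2) (B ij.1 ij.2))
  (r := index_enum ('I_n * 'I_p)%type)); last first.
  move=> [i j] _ /=; rewrite -(coord_law i)//.
rewrite -(pair_bigA _ (fun i j => normal_prob 0 (sigma j) (B i j)))/=.
rewrite (eq_bigl predT); last by move=> i; rewrite inE.
by apply: eq_bigr => i _; rewrite row_box.
Qed.

Lemma standardized_mgf ij t :
  (\int[P]_w (expR (t * standardized ij w))%:E = (expR (t ^+ 2 / 2))%:E)%E.
Proof.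
case: ij => i j; rewrite /standardized /=.
set s := Num.sqrt _; have s0 : 0 < s by rewrite sqrtr_gt0.
pose Y w : measurableTypeR R := tnth (X i w) j.
have mY : measurable_fun setT Y.
  apply: (@measurableT_comp _ _ _ _ _ _ (fun x : p.-tuple R => tnth x j)).
    exact: measurable_tnth.
  exact: measurable_funPT.
have me : measurable_fun setT
    (fun x : measurableTypeR R => (expR (t * s * x))%:E : \bar R).
  by apply/measurable_EFinP; apply: measurableT_comp => //; exact: measurable_funM.
pose nu : {measure set (measurableTypeR R) -> \bar R} := pushforward P Y.
have e0 : {in [set: measurableTypeR R], forall x : measurableTypeR R,
    (0 <= (expR (t * s * x))%:E :> \bar R)%E}.
  by move=> x _; rewrite lee_fin expR_ge0.
transitivity (\int[nu mY]_x (expR (t * s * x))%:E)%E.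
  have -> := ge0_integral_pushforward mY P measurableT me e0.
  by apply: eq_integral => w _ /=; rewrite mulrA.
transitivity (\int[normal_prob 0 (sigma j)]_x (expR (t * s * x))%:E)%E.
  by apply: eq_measure_integral => B mB _; exact: coord_law.
rewrite normal_prob_mgf// /sigma -/s; congr (expR (_ ^+ 2 / 2))%:E.
by rewrite mulfK// gt_eqF.
Qed.

End rows.
End gaussian_rows.

(** * The lower bound *)


Lemma L_ssym_argmin_ge (R : realType) (n p : nat) (X : 'M[R]_(n, p))
    (Theta Theta_star : 'M[R]_p) (t : R) :
  (0 < n)%N -> (0 < p)%N ->
  is_diag_mx Theta_star -> (forall j, 0 < Theta_star j j) ->
  is_argmin M_matrices (stein_objective (sample_covariance X)) Theta ->
  (forall k, t <= \sum_(j | j != k)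
     `|\sum_i (Num.sqrt (Theta_star k k) * X i k) *
              (Num.sqrt (Theta_star j j) * X i j)|) ->
  (2 * p%:R)^-1 * (t / (2 * n%:R) - 2) <= L_ssym Theta Theta_star.
Proof.
move=> n0 p0 dT dT0 minT tle; set S := sample_covariance X in minT.
have symS : S^T = S by rewrite /S /sample_covariance linearZ/= trmx_mul trmxK.
have n0R : 0 < n%:R :> R by rewrite ltr0n.
have p0R : 0 < p%:R :> R by rewrite ltr0n.
pose h j := Num.sqrt (Theta_star j j).
have h0 j : 0 <= h j by exact: sqrtr_ge0.
pose Z i j := h j * X i j.
pose G k j := \sum_i Z i k * Z i j.
have GE k j : h k * h j * S k j = n%:R^-1 * G k j.
  rewrite /S /sample_covariance mxE mulrCA; congr (_ * _).
  rewrite mxE mulr_sumr; apply: eq_bigr => i _; rewrite mxE /Z; ring.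
apply: le_trans (L_ssym_ge p0 (argmin_sym minT) (argmin_psd minT)
  (argmin_unitmx minT) dT dT0).
apply: ler_wpM2l; first by rewrite invr_ge0 mulr_ge0.
rewrite lerD2r.
(* The left-hand side is the positive part of the rescaled entry of [S]: the entrywise bound by [S]
   and nonnegativity are combined. *)
have low k j : n%:R^-1 / 2 * (G k j + `|G k j|) <= h k * h j * invmx Theta k j.
  have hh : 0 <= h k * h j by rewrite mulr_ge0.
  have H1 : n%:R^-1 * G k j <= h k * h j * invmx Theta k j.
    by rewrite -GE ler_wpM2l// argmin_offdiag_ge.
  have H2 : 0 <= h k * h j * invmx Theta k j.
    by rewrite mulr_ge0// (argmin_inv_ge0 minT).
  by have [g0|g0] := ger0P (G k j); [move: H1|move: H2]; clear; lra.
have sumG : 0 <= \sum_k \sum_j G k j.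
  have -> : \sum_k \sum_j G k j = \sum_i (\sum_j Z i j) ^+ 2.
    under eq_bigr do rewrite exchange_big.
    rewrite exchange_big; apply: eq_bigr => i _.
    rewrite expr2 mulr_suml; apply: eq_bigr => k _.
    by rewrite mulr_sumr.
  by apply: sumr_ge0 => i _; exact: sqr_ge0.
have sumGa : p%:R * t <= \sum_k \sum_j `|G k j|.
  rewrite -[p in p%:R]card_ord mulr_natl -sumr_const; apply: ler_sum => k _.
  apply: le_trans (tle k) _; rewrite [leRHS](bigID (fun j => j != k))/=.
  by rewrite lerDl sumr_ge0.
rewrite [leRHS]mulrC ler_pdivlMr//.
apply: (@le_trans _ _ (\sum_k \sum_j n%:R^-1 / 2 * (G k j + `|G k j|))); last first.
  by apply: ler_sum => k _; apply: ler_sum => j _; exact: low.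
under [leRHS]eq_bigr do rewrite -mulr_sumr big_split/=.
rewrite -mulr_sumr big_split/=.
have -> : t / (2 * n%:R) * p%:R = n%:R^-1 / 2 * (p%:R * t).
  by field; rewrite gt_eqF.
apply: ler_wpM2l; first by rewrite mulr_ge0// invr_ge0 ltW.
by move: sumG sumGa; clear; lra.
Qed.

Lemma measure_bigsetU_le d (T : measurableType d) (R : realType)
    (P : {measure set T -> \bar R}) (I : Type) (s : seq I) (A : I -> set T) :
  (forall i, measurable (A i)) ->
  (P (\big[setU/set0]_(i <- s) A i) <= \sum_(i <- s) P (A i))%E.
Proof.
move=> mA; elim: s => [|i s IH]; first by rewrite !big_nil measure0.
rewrite !big_cons; apply: le_trans (measureU2 _ _ _) _ => //.
  exact: bigsetU_measurable.
exact: leeD.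
Qed.

Theorem theorem4 (R : realType) :
  exists c1 c2 : R, 0 < c1 /\ 0 < c2 /\
  forall (n p : nat) (Theta_star : 'M[R]_p)
    (d : measure_display) (T : measurableType d) (P : probability T R)
    (X : 'I_n -> {RV P >-> p.-tuple R}) (Theta_hat : T -> 'M[R]_p),
  (2 <= n)%N -> (1 <= p)%N ->
  Num.sqrt n%:R <= c1 * p%:R ->
  is_diag_mx Theta_star -> (forall j : 'I_p, 0 < Theta_star j j) ->
  mutually_independent X ->
  (forall i : 'I_n, has_mvnormal_law (X i) 0 (invmx Theta_star)) ->
  {ae P, forall w, is_argmin M_matrices
     (stein_objective (sample_covariance (data_matrix X w))) (Theta_hat w)} ->
  exists E : set T,
    [/\ measurable E,
        E `<=` [set w | c1 / (2 * Num.sqrt n%:R)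
                        <= L_ssym (Theta_hat w) Theta_star] &
        ((1 - 3 * p%:R * expR (- c2 * (minn n p)%:R))%:E <= P E)%E].
Proof.
have b1 : laplace_bound < 1 :> R := laplace_bound_lt1.
have b2 : 2^-1 <= laplace_bound :> R := laplace_bound_ge.
have b0 : 0 < laplace_bound :> R by apply: lt_le_trans b2.
(* [L] is the exponential rate gained per independent factor. *)
have [L [L0 LE L2]] : exists L : R,
    [/\ 0 < L, laplace_bound = expR (- L) & expR L <= 2].
  exists (- ln laplace_bound); split; first by rewrite oppr_gt0 ln_lt0// b0.
    by rewrite opprK lnK.
  by rewrite expRN lnK// -[leRHS]invrK lef_pV2 ?posrE.
(* The column bound gives loss at least [(L^2 / 16) / sqrt n - 1/p], and [sqrt n <= c1 p] gives
   [1/p <= c1 / sqrt n]. With [c1 = L^2 / 24], what remains is [(3/2 - 1) c1 / sqrt n]. The rate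
   [c2] is that of the column tail. *)
exists (L ^+ 2 / 24), (L / 2); split; first by rewrite divr_gt0// exprn_gt0.
split; first by rewrite divr_gt0.
move=> n p Theta d T P X Theta_hat n2 p1 np diagT T0 indepX lawX argT.
have n0 : (0 < n)%N by exact: leq_trans n2.
have n0R : 0 < n%:R :> R by rewrite ltr0n.
have p0R : 0 < p%:R :> R by rewrite ltr0n.
pose Z := standardized Theta X.
have mZ : forall ij, measurable_fun setT (Z ij) := measurable_standardized Theta X.
have indepZ : box_independent P Z := standardized_independent diagT T0 indepX lawX.
have mgfZ := standardized_mgf diagT T0 lawX.
set sqn := Num.sqrt n%:R in np *.
have sqn0 : 0 < sqn by rewrite sqrtr_gt0.
have sqnE : sqn * sqn = n%:R by rewrite -expr2 sqr_sqrtr ?ler0n.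
pose t := L ^+ 2 / 4 * p%:R * sqn.
pose bad k := [set w | \sum_(j | j != k) `|\sum_i Z (i, k) w * Z (i, j) w| < t].
have mbad k : measurable (bad k).
  pose g w := \sum_(j | j != k) `|\sum_i Z (i, k) w * Z (i, j) w|.
  have mg : measurable_fun setT g.
    exact: (measurableT_comp (measurable_column_gram k) (measurable_sample mZ)).
  have := mg measurableT `]-oo, t[%classic (measurable_itv _).
  rewrite setTI; suff -> : bad k = g @^-1` `]-oo, t[%classic by [].
  by apply/seteqP; split => w; rewrite /= in_itv.
have [N [mN PN0 NP]] := argT.
pose B := \big[setU/set0]_(k < p) bad k.
have mB : measurable B by apply: bigsetU_measurable.
(* Outside a null set where minimality may fail and the event [B] that some column is bad, the
   deterministic bound applies. *)
exists (~` (N `|` B)); split.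
- by apply: measurableC; exact: measurableU.
- move=> w wE /=.
  have minT : is_argmin M_matrices
      (stein_objective (sample_covariance (data_matrix X w))) (Theta_hat w).
    by apply: contrapT => Hw; apply: wE; left; exact: NP.
  have tle k : t <= \sum_(j | j != k) `|\sum_i
      (Num.sqrt (Theta k k) * data_matrix X w i k) *
      (Num.sqrt (Theta j j) * data_matrix X w i j)|.
    rewrite leNgt; apply/negP => lt_t; apply: wE; right.
    rewrite /B (bigD1 k)//=; left; move: lt_t; rewrite /bad /=.
    by under eq_bigr do under eq_bigr do rewrite !mxE.
  apply: le_trans (L_ssym_argmin_ge n0 p1 diagT T0 minT tle).
  have -> : (2 * p%:R)^-1 * (t / (2 * n%:R) - 2) =
      L ^+ 2 / 16 / sqn - p%:R^-1.
    by rewrite /t -sqnE; field; rewrite !gt_eqF.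
  have : p%:R^-1 <= L ^+ 2 / 24 / sqn.
    by rewrite ler_pdivlMr// mulrC ler_pdivrMr.
  have -> : L ^+ 2 / 24 / (2 * sqn) = 2^-1 * (L ^+ 2 / 24 / sqn).
    by field; rewrite gt_eqF.
  have -> : L ^+ 2 / 16 / sqn = 3 / 2 * (L ^+ 2 / 24 / sqn).
    by field; rewrite gt_eqF.
  by clear; lra.
- rewrite probability_setC; last exact: measurableU.
  (* Union bound over the [p] columns; 3 is the sum of the coefficients 2 and 1 in the column
     tail. *)
  have PNB : (P (N `|` B) <= (3 * p%:R * expR (- (L / 2) * (minn n p)%:R))%:E)%E.
    apply: (@le_trans _ _ (P N + P B)%E); first exact: measureU2.
    have PN : (P N <= 0)%E by move: PN0 => ->.
    apply: le_trans (leeD PN (measure_bigsetU_le P _ mbad)) _.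
    rewrite add0e.
    apply: (@le_trans _ _ (\sum_(k < p)
        (3 * expR (- (L / 2) * (minn n p)%:R))%:E)%E).
      apply: lee_sum => k _.
      apply: le_trans (column_gram_lower_tail mZ indepZ mgfZ k n0 L0 LE L2) _.
      rewrite lee_fin.
      have e1 : expR (- (L / 2 * p%:R)) <= expR (- (L / 2) * (minn n p)%:R).
        rewrite ler_expR mulNr lerN2 ler_wpM2l ?ler_nat ?geq_minr//.
        by rewrite ltW// divr_gt0.
      have e2 : expR (- (L / 2 * n%:R)) <= expR (- (L / 2) * (minn n p)%:R).
        rewrite ler_expR mulNr lerN2 ler_wpM2l ?ler_nat ?geq_minl//.
        by rewrite ltW// divr_gt0.
      by move: e1 e2; clear; lra.
    by rewrite sumEFin sumr_const card_ord lee_fin -[leLHS]mulr_natl mulrA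
      (mulrC p%:R).
  rewrite EFinB; exact: leeB.
Qed.
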